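(* Let $A$ be a unital C*-algebra. Let $\mathcal F$ be the frame of all families $\underline U=(\underline U(C))_{C\in\mathcal C(A)}$ with $\underline U(C)\subseteq L_C$ such that (i) if $D^C_a\in\underline U(C)$ and $C\subseteq C'$ then $D^{C'}_a\in\underline U(C')$, and (ii) for every $C\in\mathcal C(A)$ and every $D^C_a\in L_C$: $D^C_a\in\underline U(C)$ iff $D^C_a\vartriangleleft_C\underline U(C)$; with meets $(\underline U\wedge\underline V)(C)=\underline U(C)\cap\underline V(C)$, top element $C\mapsto L_C$, and joins $(\bigvee_i\underline U_i)(C)=\{D^C_a\in L_C\mid D^C_a\vartriangleleft_C\bigcup_i\underline U_i(C)\}$. Then the map $$\Psi:\mathcal F\to\mathcal O\Sigma_\ast,\qquad \Psi(\underline U)_C=\bigcup_{D^C_a\in\underline U(C)}X^C_a,$$ is well defined (i.e. $\Psi(\underline U)$ is open in $\Sigma_\ast$) and is an isomorphism of frames: it is bijective and preserves finite meets and arbitrary joins.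
   Context: Let $A$ be a unital C*-algebra. $\mathcal C(A)$ is the poset (under inclusion) of commutative C*-subalgebras of $A$ containing the unit of $A$ (including $\mathbb C\cdot1$). For $C\in\mathcal C(A)$, $\Sigma_C$ is its Gelfand spectrum; for $C\subseteq C'$ and $\lambda'\in\Sigma_{C'}$, $\lambda'|_C$ is the restriction. For $C\in\mathcal C(A)$: $C^+=\{a\in C_{sa}\mid a\ge0\}$; $a\precsim b$ iff $a\le nb$ for some $n\in\mathbb N$; $L_C$ is the set of classes of $C^+$ under $a\approx b\iff(a\precsim b\wedge b\precsim a)$, a distributive lattice ordered by $\precsim$ with $[x]\vee[y]=[x\vee y]$. For $a\in C_{sa}$, $D^C_a:=[a^+]$ ($a^+$ the positive part); $D^C_{a-q}:=[(a-q\cdot1)^+]$. For $U\subseteq L_C$, $D^C_a\vartriangleleft_C U$ iff for every rational $q>0$ there is a finite $U_0\subseteq U$ with $D^C_{a-q}\le\bigvee U_0$. For $a\in C_{sa}$, $X^C_a=\{\lambda\in\Sigma_C\mid\lambda(a)>0\}$ (it depends only on $D^C_a$). Let $\Sigma=\{(C,\lambda)\mid C\in\mathcal C(A),\lambda\in\Sigma_C\}$ and $U_C=\{\lambda\mid(C,\lambda)\in U\}$. The space $\Sigma_\ast$ is $\Sigma$ with the topology $\mathcal O\Sigma_\ast$: $U$ is open iff (1) each $U_C$ is open in $\Sigma_C$, and (2) if $\lambda\in U_C$, $C\subseteq C'$ and $\lambda'\in\Sigma_{C'}$ with $\lambda'|_C=\lambda$, then $\lambda'\in U_{C'}$. ($\mathcal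 F$ is the external description, at the bottom context $\mathbb C\cdot 1$, of the frame of the internal Gelfand spectrum of the Bohrification $\underline A$ in $[\mathcal C(A),\mathbf{Set}]$.) *)

(* Defs.v *)
From Stdlib Require Import Reals QArith Qreals List ClassicalEpsilon.
Open Scope R_scope.

Definition Cpx : Type := (R * R)%type.
Definition Cadd (z w : Cpx) : Cpx := (fst z + fst w, snd z + snd w).
Definition Cmul (z w : Cpx) : Cpx :=
  (fst z * fst w - snd z * snd w, fst z * snd w + snd z * fst w).
Definition Cconj (z : Cpx) : Cpx := (fst z, - snd z).
Definition Csub (z w : Cpx) : Cpx := (fst z - fst w, snd z - snd w).
Definition Cmod (z : Cpx) : R := sqrt (fst z * fst z + snd z * snd z).
Definition Cone : Cpx := (1, 0).
Definition Czero : Cpx := (0, 0).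

Record CStarAlg : Type := {
  car :> Type;
  zr : car; un : car;
  add : car -> car -> car; opp : car -> car;
  mul : car -> car -> car; scal : Cpx -> car -> car;
  star : car -> car; nrm : car -> R;
  addA : forall x y z, add x (add y z) = add (add x y) z;
  addC : forall x y, add x y = add y x;
  add0 : forall x, add zr x = x;
  addN : forall x, add x (opp x) = zr;
  scal1 : forall x, scal Cone x = x;
  scalA : forall a b x, scal a (scal b x) = scal (Cmul a b) x;
  scalDl : forall a b x, scal (Cadd a b) x = add (scal a x) (scal b x);
  scalDr : forall a x y, scal a (add x y) = add (scal a x) (scal a y);
  mulA : forall x y z, mul x (mul y z) = mul (mul x y) z;
  mul1l : forall x, mul un x = x;
  mul1r : forall x, mul x un = x;
  mulDl : forall x y z, mul (add x y) z = add (mul x z) (mul y z);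
  mulDr : forall x y z, mul x (add y z) = add (mul x y) (mul x z);
  scal_mull : forall a x y, scal a (mul x y) = mul (scal a x) y;
  scal_mulr : forall a x y, scal a (mul x y) = mul x (scal a y);
  star_add : forall x y, star (add x y) = add (star x) (star y);
  star_scal : forall a x, star (scal a x) = scal (Cconj a) (star x);
  star_mul : forall x y, star (mul x y) = mul (star y) (star x);
  star_star : forall x, star (star x) = x;
  nrm_eq0 : forall x, nrm x = 0 -> x = zr;
  nrm_triangle : forall x y, nrm (add x y) <= nrm x + nrm y;
  nrm_scal : forall a x, nrm (scal a x) = Cmod a * nrm x;
  nrm_submul : forall x y, nrm (mul x y) <= nrm x * nrm y;
  complete : forall u : nat -> car,
    (forall eps, eps > 0 -> exists N, forall n m, (n >= N)%nat -> (m >= N)%nat ->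
        nrm (add (u n) (opp (u m))) < eps) ->
    exists l, forall eps, eps > 0 -> exists N, forall n, (n >= N)%nat ->
        nrm (add (u n) (opp l)) < eps;
  cstar_id : forall x, nrm (mul (star x) x) = nrm x * nrm x
}.

Arguments zr {_}. Arguments un {_}. Arguments add {_}. Arguments opp {_}.
Arguments mul {_}. Arguments scal {_}. Arguments star {_}. Arguments nrm {_}.

Section Defs.
Variable A : CStarAlg.

Definition sub (x y : A) : A := add x (opp y).
Definition rscal (r : R) (x : A) : A := scal (r, 0) x.

Definition converges (u : nat -> A) (l : A) : Prop :=
  forall eps, eps > 0 -> exists N, forall n, (n >= N)%nat -> nrm (sub (u n) l) < eps.

Definition isCommSub (S : A -> Prop) : Prop :=
  S un /\
  (forall x y, S x -> S y -> S (add x y)) /\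
  (forall x y, S x -> S y -> S (mul x y)) /\
  (forall a x, S x -> S (scal a x)) /\
  (forall x, S x -> S (star x)) /\
  (forall x y, S x -> S y -> mul x y = mul y x) /\
  (forall u l, (forall n, S (u n)) -> converges u l -> S l).

Definition subset (S S' : A -> Prop) : Prop := forall x, S x -> S' x.

(* Gelfand spectrum: characters of S, normalized to be 0 outside S so that
   a character is determined by its values on S *)
Definition isChar (S : A -> Prop) (l : A -> Cpx) : Prop :=
  (forall x y, S x -> S y -> l (add x y) = Cadd (l x) (l y)) /\
  (forall a x, S x -> l (scal a x) = Cmul a (l x)) /\
  (forall x y, S x -> S y -> l (mul x y) = Cmul (l x) (l y)) /\
  l un = Cone /\
  (forall x, ~ S x -> l x = Czero).

Definition Pt : Type := ((A -> Prop) * (A -> Cpx))%type.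
Definition isPt (p : Pt) : Prop := isCommSub (fst p) /\ isChar (fst p) (snd p).

Definition openIn (S : A -> Prop) (W : (A -> Cpx) -> Prop) : Prop :=
  forall l, isChar S l -> W l ->
    exists (xs : list A) (eps : R), eps > 0 /\ (forall a, In a xs -> S a) /\
      forall m, isChar S m -> (forall a, In a xs -> Cmod (Csub (m a) (l a)) < eps) -> W m.

Definition isOpen (O : Pt -> Prop) : Prop :=
  (forall p, O p -> isPt p) /\
  (forall S, isCommSub S -> openIn S (fun l => O (S, l))) /\
  (forall S S' l l', O (S, l) -> isCommSub S' -> subset S S' -> isChar S' l' ->
      (forall x, S x -> l' x = l x) -> O (S', l')).

Definition invertible (x : A) : Prop := exists y, mul x y = un /\ mul y x = un.
Definition spec (a : A) (z : Cpx) : Prop := ~ invertible (sub a (scal z un)).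
Definition selfadj (a : A) : Prop := star a = a.
Definition positive (a : A) : Prop :=
  selfadj a /\ forall z, spec a z -> snd z = 0 /\ fst z >= 0.
Definition le (a b : A) : Prop := positive (sub b a).

Definition prec (a b : A) : Prop := exists n : nat, le a (rscal (INR n) b).
Definition approx (a b : A) : Prop := prec a b /\ prec b a.

(* positive part a^+: the unique p with p >= 0, p >= a and p (p - a) = 0 *)
Definition isPosPart (a p : A) : Prop :=
  positive p /\ le a p /\ mul p (sub p a) = zr.
Definition posp (a : A) : A := epsilon (inhabits zr) (isPosPart a).

Definition sup (x y : A) : A := add x (posp (sub y x)).
Definition bigsup (l : list A) : A := fold_right sup zr l.

(* Elements of L_C are represented by elements of C^+ (classes under approx);
   a subset of L_C is represented by an approx-saturated predicate on C^+.
   D^C_a is the class of posp a. *)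
Definition Cpos (S : A -> Prop) (x : A) : Prop := S x /\ positive x.

Definition covers (S : A -> Prop) (a : A) (U : A -> Prop) : Prop :=
  forall q : Q, (0 < q)%Q ->
    exists l : list A, (forall u, In u l -> U u) /\
      prec (posp (sub a (rscal (Q2R q) un))) (bigsup l).

Definition fam : Type := (A -> Prop) -> A -> Prop.

Definition inF (U : fam) : Prop :=
  (* encoding: U(C) is a subset of L_C, and U is empty off C(A) *)
  (forall S x, U S x -> isCommSub S /\ Cpos S x) /\
  (forall S x y, U S x -> Cpos S y -> approx x y -> U S y) /\
  (forall S S' a, isCommSub S -> isCommSub S' -> subset S S' -> S a -> selfadj a ->
      U S (posp a) -> U S' (posp a)) /\
  (forall S a, isCommSub S -> S a -> selfadj a ->
      (U S (posp a) <-> covers S a (U S))).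

Definition topF : fam := fun S x => isCommSub S /\ Cpos S x.
Definition meetF (U V : fam) : fam := fun S x => U S x /\ V S x.
Definition joinF (I : Type) (Us : I -> fam) : fam :=
  fun S x => isCommSub S /\ Cpos S x /\ covers S x (fun y => exists i, Us i S y).

Definition Psi (U : fam) : Pt -> Prop :=
  fun p => isPt p /\ exists a, U (fst p) a /\ exists r, r > 0 /\ snd p a = (r, 0).

End Defs.

(* Main.v *)
From mathcomp Require classical_sets.
Require Import Defs.
From Stdlib Require Import Reals QArith Qreals List ClassicalEpsilon.
From Stdlib Require Import Lra Lia FunctionalExtensionality PropExtensionality.

(** For a commutative C*-algebra [B], every [1 - x] with [|x| <= 1] has a square root, given by a
    norm convergent iteration; the C*-identity then makes the squares of selfadjoint elements a
    cone closed under sums and products. By Zorn's lemma every preordering of the selfadjoint part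
    that contains the squares but not [-1] extends to a maximal one, which is total, and the cut
    [sup {r | a - r >= 0}] it induces is a character. Applied to suitable preorderings, this one
    principle yields the whole of the Gelfand theory required: spectral values are character values,
    characters separate points, and the sets [{l | q <= l a}] are compact.

    Hence for [a] and [U] in [C], [D_a] is covered by [U] iff [X_a] is included in the union of the
    [X_u], for [u] in [U]. So a family in the frame is determined by the open sets it induces, and
    conversely the open sets [X_a] form a basis of the topology of the spectrum of [C]. *)

Set Bullet Behavior "Strict Subproofs".
Local Open Scope R_scope.

Declare Scope alg_scope.
Delimit Scope alg_scope with alg.
Arguments nrm {_} _%_alg_scope.
Arguments add {_} _%_alg_scope _%_alg_scope.
Arguments mul {_} _%_alg_scope _%_alg_scope.
Arguments opp {_} _%_alg_scope.
Arguments sub _ _%_alg_scope _%_alg_scope.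
Arguments star {_} _%_alg_scope.
Arguments scal {_} _%_R_scope _%_alg_scope.
Notation "x + y" := (add x y) : alg_scope.
Notation "x * y" := (mul x y) : alg_scope.
Notation "- x" := (opp x) : alg_scope.
Notation "x - y" := (sub _ x y) : alg_scope.
Notation "0" := zr : alg_scope.
Notation "1" := un : alg_scope.

(** The definitions measure positivity, and with it [prec] and [posp], by the spectrum in the whole
    of [A], whereas characters live on a commutative [S]. Two bridges shape the second half. One is
    spectral permanence: an element of [S] invertible in [A] is not killed by any character of [S],
    so that order in [A] becomes pointwise order on the spectrum of each [S]. The other concerns
    [posp], which is an arbitrary choice in [A]: it has to be unique, and to lie in every [S]
    containing [a], before condition (i) even speaks of elements of [S']. After that every notion is
    pointwise: [prec] is domination up to an integer factor, [posp] and [bigsup] are maxima with 0,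
    and the finiteness in [covers] is compactness. *)

Definition cst {A : CStarAlg} (r : R) : A := scal (r, 0) un.
Arguments cst {A} r%_R_scope.

Lemma Cmod_real r : Cmod (r, 0) = Rabs r.
Proof.
unfold Cmod; simpl.
replace (r * r + 0 * 0) with (Rsqr r) by (unfold Rsqr; ring).
apply sqrt_Rsqr_abs.
Qed.

Lemma Cmod_sq z : Cmod z * Cmod z = fst z * fst z + snd z * snd z.
Proof. apply sqrt_sqrt. nra. Qed.

Lemma Cmod_ge0 z : 0 <= Cmod z.
Proof. apply sqrt_pos. Qed.

Lemma exists_small_Q (r : R) : (0 < r)%R -> exists q : Q, (0 < q)%Q /\ (Q2R q < r)%R.
Proof.
intro Hr. destruct (archimed_cor1 r Hr) as [n [Hn Hpos]].
exists (1 # Pos.of_nat n). split; [reflexivity|].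
unfold Q2R. simpl. rewrite Rmult_1_l.
replace (IZR (Z.pos (Pos.of_nat n))) with (INR n); [assumption|].
change (INR n = IPR (Pos.of_nat n)). now rewrite <- INR_IPR, Nat2Pos.id by lia.
Qed.

Lemma Rle_eps_mul (x K : R) : 0 <= K -> (forall eps, eps > 0 -> x <= K * eps) -> x <= 0.
Proof.
intros HK H. destruct (Rle_dec x 0) as [|Hn]; [assumption|].
assert (H1 : x / (2 * (K + 1)) > 0) by (apply Rdiv_lt_0_compat; lra).
specialize (H _ H1).
assert (E : K * (x / (2 * (K + 1))) = x * (K / (2 * (K + 1)))) by (field; lra).
rewrite E in H.
assert (K / (2 * (K + 1)) <= 1 / 2).
{ apply Rmult_le_reg_r with (2 * (K + 1)); [lra|].
  unfold Rdiv at 1. rewrite Rmult_assoc, Rinv_l by lra. lra. }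
nra.
Qed.

(** * Algebra and norm estimates in an arbitrary C*-algebra *)

Section Basics.
Variable A : CStarAlg.
Local Open Scope alg_scope.
Implicit Types (x y z : A) (r t : R).

Lemma add0r x : x + 0 = x.
Proof. rewrite addC. apply add0. Qed.

Lemma addNl x : - x + x = 0.
Proof. rewrite addC. apply addN. Qed.

Lemma add_cancel x y z : x + y = x + z -> y = z.
Proof.
intro H. rewrite <- (add0 A y), <- (add0 A z), <- (addNl x), <- !addA, H. reflexivity.
Qed.

Lemma scal0 x : scal (0, 0)%R x = 0.
Proof.
apply (add_cancel (scal (0, 0)%R x)). rewrite <- scalDl, add0r.
f_equal. unfold Cadd; simpl. f_equal; ring.
Qed.

Lemma opp_unique x y : x + y = 0 -> y = - x.
Proof. intro H. apply (add_cancel x). now rewrite H, addN. Qed.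

Lemma oppE x : - x = scal (-1, 0)%R x.
Proof.
symmetry; apply opp_unique. rewrite <- (scal1 A x) at 1. rewrite <- scalDl, <- (scal0 x).
f_equal. unfold Cadd; simpl; f_equal; ring.
Qed.

Lemma sub_eq0 x y : x - y = 0 -> x = y.
Proof.
unfold sub. intro H. apply (add_cancel (- y)). rewrite (addC A _ x), H. now rewrite addNl.
Qed.

Lemma cst_mul r x : cst r * x = scal (r, 0)%R x.
Proof. unfold cst. now rewrite <- scal_mull, mul1l. Qed.

Lemma cst_comm r x : x * cst r = cst r * x.
Proof. rewrite cst_mul. unfold cst. now rewrite <- scal_mulr, mul1r. Qed.

Lemma cst0 : @cst A 0 = 0.
Proof. apply scal0. Qed.

Lemma cst1 : @cst A 1 = 1.
Proof. apply scal1. Qed.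

Lemma cstD r t : @cst A (r + t)%R = cst r + cst t.
Proof. unfold cst. rewrite <- scalDl. f_equal. unfold Cadd; simpl; f_equal; ring. Qed.

Lemma cstM r t : @cst A (r * t)%R = cst r * cst t.
Proof.
rewrite cst_mul. unfold cst. rewrite scalA. f_equal. unfold Cmul; simpl; f_equal; ring.
Qed.

Lemma cstN r : @cst A (- r)%R = - cst r.
Proof. apply opp_unique. rewrite <- cstD, Rplus_opp_r. apply cst0. Qed.

Lemma cstB r t : @cst A (r - t)%R = cst r - cst t.
Proof. unfold Rminus, sub. now rewrite cstD, cstN. Qed.

Lemma star0 : star (0 : A) = 0.
Proof. apply (add_cancel (star 0)). now rewrite <- star_add, !add0r. Qed.

Lemma starN x : star (- x) = - star x.
Proof. apply opp_unique. now rewrite <- star_add, addN, star0. Qed.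

Lemma starB x y : star (x - y) = star x - star y.
Proof. unfold sub. now rewrite star_add, starN. Qed.

Lemma star1 : star (1 : A) = 1.
Proof. rewrite <- (mul1l A (star 1)), <- (star_star A 1) at 1. rewrite <- star_mul, mul1l. apply star_star. Qed.

Lemma star_cst r : star (@cst A r) = cst r.
Proof. unfold cst. rewrite star_scal, star1. f_equal. unfold Cconj; simpl; f_equal; ring. Qed.

Lemma nrm0 : nrm (0 : A) = 0%R.
Proof.
rewrite <- (scal0 0), nrm_scal, Cmod_real, Rabs_R0. ring.
Qed.

Lemma nrmN x : nrm (- x) = nrm x.
Proof. rewrite oppE, nrm_scal, Cmod_real, Rabs_left by lra. ring. Qed.

Lemma nrm_ge0 x : (0 <= nrm x)%R.
Proof.
generalize (nrm_triangle A x (- x)). rewrite addN, nrm0, nrmN. lra.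
Qed.

Lemma nrm_triangleB x y : (nrm (x - y) <= nrm x + nrm y)%R.
Proof. unfold sub. rewrite <- (nrmN y). apply nrm_triangle. Qed.

Lemma nrm_subC x y : nrm (x - y) = nrm (y - x).
Proof.
rewrite <- nrmN. f_equal. symmetry. apply opp_unique. unfold sub.
rewrite addA, <- (addA _ x), addNl, add0r. apply addN.
Qed.

Lemma nrm_star x : nrm (star x) = nrm x.
Proof.
assert (H : forall z, (nrm z <= nrm (star z))%R).
{ intro z. generalize (cstar_id A z) (nrm_submul A (star z) z) (nrm_ge0 z) (nrm_ge0 (star z)).
  intros. destruct (Req_dec (nrm z) 0); nra. }
apply Rle_antisym; [|apply H]. generalize (H (star x)). now rewrite star_star.
Qed.

(** Only an inequality, since the zero algebra is allowed and there [nrm 1 = 0]. *)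
Lemma nrm1 : (nrm (1 : A) <= 1)%R.
Proof.
generalize (cstar_id A 1) (nrm_ge0 1). rewrite star1, mul1l. intros. nra.
Qed.

Lemma nrm_cst r : (nrm (@cst A r) <= Rabs r)%R.
Proof.
unfold cst. rewrite nrm_scal, Cmod_real. generalize nrm1 (Rabs_pos r). nra.
Qed.

Lemma nrm_cstM r x : nrm (cst r * x) = (Rabs r * nrm x)%R.
Proof. now rewrite cst_mul, nrm_scal, Cmod_real. Qed.

Lemma nrm_small x (K : R) : (0 <= K)%R ->
  (forall eps, (eps > 0)%R -> (nrm x <= K * eps)%R) -> x = 0.
Proof.
intros HK H. apply nrm_eq0. generalize (nrm_ge0 x) (Rle_eps_mul _ K HK H). lra.
Qed.

Lemma nrm_of_isometry x K : (0 <= K)%R -> star x * x = cst (K * K) -> (nrm x <= K)%R.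
Proof.
intros HK H. generalize (cstar_id A x) (nrm_cst (K * K)) (nrm_ge0 x).
rewrite H, Rabs_right by nra. intros. nra.
Qed.

Lemma sub_triangle x y z : (nrm (x - z) <= nrm (x - y) + nrm (y - z))%R.
Proof.
replace (x - z) with ((x - y) + (y - z)); [apply nrm_triangle|].
unfold sub. now rewrite <- addA, (addA _ (- y)), addNl, add0.
Qed.

(** Method of majorants: [u] is an iteration in the algebra and [s] the same iteration run on real
    numbers. The increments of [s] telescope, so a bound on [s] alone makes [u] Cauchy. *)
Lemma majorized_increments_cvg (u : nat -> A) (s : nat -> R) (M : R) :
  (forall n, s n <= M)%R ->
  (forall n, nrm (u (S n) - u n) <= s (S n) - s n)%R ->
  exists l, converges A u l.
Proof.
intros Hs Hu.
assert (Hmn : forall n k, (nrm (u (n + k)%nat - u n) <= s (n + k)%nat - s n)%R).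
{ intros n; induction k as [|k IH].
  - rewrite Nat.add_0_r. unfold sub. rewrite addN, nrm0. lra.
  - rewrite Nat.add_succ_r. specialize (Hu (n + k)%nat).
    generalize (sub_triangle (u (S (n + k))) (u (n + k)%nat) (u n)). lra. }
assert (Hg : Un_growing s).
{ intro n. specialize (Hu n). generalize (nrm_ge0 (u (S n) - u n)). lra. }
assert (Hc : Cauchy_crit s).
{ destruct (growing_cv s Hg) as [l Hl].
  - exists M. intros x [n ->]. apply Hs.
  - apply CV_Cauchy. now exists l. }
apply complete. intros eps He. destruct (Hc eps He) as [N HN].
exists N. intros n m Hn Hm.
assert (Hle : forall p q, (p >= N)%nat -> (q >= N)%nat -> (p <= q)%nat -> (nrm (u q - u p) < eps)%R).
{ intros p q Hp Hq Hpq. replace q with (p + (q - p))%nat by lia.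
  eapply Rle_lt_trans; [apply Hmn|].
  specialize (HN q p Hq Hp). unfold Rdist in HN. replace (p + (q - p))%nat with q by lia.
  apply Rabs_def2 in HN. lra. }
fold (sub A (u n) (u m)).
destruct (Nat.le_ge_cases n m).
- rewrite nrm_subC. now apply Hle.
- now apply Hle.
Qed.

End Basics.

(** * Square roots and the cone of squares *)

Section Commutative.
Variable B : CStarAlg.
Hypothesis comm : forall x y : B, mul x y = mul y x.
Local Open Scope alg_scope.
Implicit Types (x y z a : B).

Lemma calg_ring : ring_theory (0 : B) 1 add mul (sub B) opp eq.
Proof.
split; intros; auto using add0, addC, addA, mul1l, mulA, mulDl, addN.
Qed.
Add Ring calg_ring : calg_ring.

Lemma half_half : cst (/ 2) + cst (/ 2) = (1 : B).
Proof. rewrite <- cstD, <- cst1. f_equal. lra. Qed.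

(** The Neumann series, as the iteration of [y = 1 + x y]; its majorant is the geometric series of
    ratio [r], bounded by its sum [/ (1 - r)]. *)
Lemma invertible_1_sub x (r : R) : (nrm x <= r)%R -> (r < 1)%R -> exists y, (1 - x) * y = 1.
Proof.
intros Hx Hr. assert (Hx0 := nrm_ge0 B x).
set (u := fix u n : B := match n with O => 0 | S n => 1 + x * u n end).
set (s := fix s n : R := match n with O => 0%R | S n => (1 + r * s n)%R end).
assert (Hs : forall n, (s n <= / (1 - r))%R).
{ assert (Hp : (0 < / (1 - r))%R) by (apply Rinv_0_lt_compat; lra).
  assert (E : (/ (1 - r) = 1 + r * / (1 - r))%R) by (field; lra).
  induction n as [|n IH]; simpl; nra. }
destruct (majorized_increments_cvg B u s _ Hs) as [y Hy].
{ induction n as [|n IH].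
  - simpl. replace (1 + x * 0 - 0) with (1 : B) by ring. generalize (nrm1 B). lra.
  - change (nrm ((1 + x * u (S n)) - (1 + x * u n)) <= (1 + r * s (S n)) - (1 + r * s n))%R.
    replace (1 + x * u (S n) - (1 + x * u n)) with (x * (u (S n) - u n)) by ring.
    generalize (nrm_submul B x (u (S n) - u n)) (nrm_ge0 B (u (S n) - u n)). nra. }
exists y. apply sub_eq0, nrm_small with 2%R; [lra|]. intros eps He.
destruct (Hy eps He) as [N HN].
assert (H0 := HN N (Nat.le_refl _)). assert (H1 := HN (S N) (Nat.le_succ_diag_r _)).
replace ((1 - x) * y - 1) with (x * (u N - y) - (u (S N) - y)) by (simpl; ring).
eapply Rle_trans; [apply nrm_triangleB|].
generalize (nrm_submul B x (u N - y)) (nrm_ge0 B (u N - y)). nra.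
Qed.

(** The equation for [y] amounts to the fixed point equation [y = (x + y^2) / 2]. When [nrm x = 1]
    no contraction estimate is available, but the scalar iteration with [x = 1] still increases and
    stays below 1, which is enough for a majorant. *)
Lemma exists_sqrt_1_sub x : (nrm x <= 1)%R -> selfadj B x ->
  exists y, selfadj B y /\ (nrm y <= 1)%R /\ (1 - y) * (1 - y) = 1 - x.
Proof.
intros Hx Sx.
set (u := fix u n : B := match n with O => 0 | S n => cst (/ 2) * (x + u n * u n) end).
set (s := fix s n : R := match n with O => 0%R | S n => (/ 2 * (1 + s n * s n))%R end).
assert (Hs : forall n, (0 <= s n <= 1)%R) by (induction n; simpl; nra).
assert (Hh : (Rabs (/ 2) = / 2)%R) by (apply Rabs_right; lra).
assert (Hu : forall n, (nrm (u n) <= s n)%R).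
{ induction n as [|n IH]; simpl; [rewrite nrm0; lra|].
  rewrite nrm_cstM, Hh.
  generalize (nrm_triangle B x (u n * u n)) (nrm_submul B (u n) (u n)) (nrm_ge0 B (u n)).
  specialize (Hs n). nra. }
destruct (majorized_increments_cvg B u s 1) as [y Hy].
{ apply Hs. }
{ induction n as [|n IH].
  - simpl. replace (cst (/ 2) * (x + 0 * 0) - 0) with (cst (/ 2) * x) by ring.
    rewrite nrm_cstM, Hh. lra.
  - change (nrm (cst (/ 2) * (x + u (S n) * u (S n)) - cst (/ 2) * (x + u n * u n)) <=
      / 2 * (1 + s (S n) * s (S n)) - / 2 * (1 + s n * s n))%R.
    replace (_ - _) with (cst (/ 2) * ((u (S n) - u n) * (u (S n) + u n))) by ring.
    rewrite nrm_cstM, Hh.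
    generalize (nrm_submul B (u (S n) - u n) (u (S n) + u n)) (nrm_triangle B (u (S n)) (u n))
      (Hu n) (Hu (S n)) (nrm_ge0 B (u (S n) - u n)) (nrm_ge0 B (u n + u (S n))) (Hs n) (Hs (S n)).
    intros.
    assert (nrm (u (S n) - u n) * nrm (u (S n) + u n) <= (s (S n) - s n) * (s (S n) + s n))%R; [|lra].
    apply Rmult_le_compat; try lra; apply nrm_ge0. }
assert (Su : forall n, star (u n) = u n).
{ induction n as [|n IH]; simpl; [apply star0|].
  rewrite star_mul, star_add, star_mul, IH, star_cst, Sx. ring. }
assert (Ny : (nrm y <= 1)%R).
{ apply Rnot_lt_le. intro Hlt. destruct (Hy (nrm y - 1)%R) as [N HN]; [lra|].
  specialize (HN N (Nat.le_refl _)). rewrite nrm_subC in HN.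
  generalize (nrm_triangle B (y - u N) (u N)) (Hu N) (Hs N).
  replace (y - u N + u N) with y by ring. lra. }
exists y. split; [|split; [assumption|]].
- apply sub_eq0, nrm_small with 2%R; [lra|]. intros eps He.
  destruct (Hy eps He) as [N HN]. specialize (HN N (Nat.le_refl _)).
  replace (star y - y) with ((u N - y) - star (u N - y)).
  + eapply Rle_trans; [apply nrm_triangleB|]. rewrite nrm_star. lra.
  + rewrite starB, Su. ring.
- apply sub_eq0, nrm_small with 4%R; [lra|]. intros eps He.
  destruct (Hy eps He) as [N HN].
  assert (H0 := HN N (Nat.le_refl _)). assert (H1 := HN (S N) (Nat.le_succ_diag_r _)).
  assert (E : u (S N) + u (S N) = x + u N * u N).
  { simpl. transitivity ((cst (/ 2) + cst (/ 2)) * (x + u N * u N)); [ring|].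
    rewrite half_half. ring. }
  replace ((1 - y) * (1 - y) - (1 - x)) with
    ((u (S N) - y) + (u (S N) - y) - (u N - y) * (u N + y)).
  + generalize (nrm_triangleB B ((u (S N) - y) + (u (S N) - y)) ((u N - y) * (u N + y)))
      (nrm_triangle B (u (S N) - y) (u (S N) - y)) (nrm_submul B (u N - y) (u N + y))
      (nrm_triangle B (u N) y) (Hu N) (Hs N) (nrm_ge0 B (u N - y)) (nrm_ge0 B (u N + y)).
    intros. nra.
  + transitivity ((u (S N) + u (S N)) - u N * u N - (y + y) + y * y); [ring|].
    rewrite E. ring.
Qed.

Definition im : B := scal (0, 1)%R 1.

Lemma im_sq : im * im = opp 1.
Proof.
unfold im. rewrite oppE, <- scal_mull, mul1l, scalA. f_equal.
unfold Cmul; simpl; f_equal; lra.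
Qed.

Lemma star_im : star im = - im.
Proof.
unfold im. rewrite star_scal, star1, oppE, scalA. f_equal.
unfold Cmul, Cconj; simpl; f_equal; lra.
Qed.

Definition is_square a : Prop := exists s, selfadj B s /\ a = s * s.

(* [w + i t] is then [K] times a unitary, and [w] is its real part. *)
Lemma nrm_le_of_sum_squares t w (K : R) : (0 <= K)%R ->
  selfadj B t -> selfadj B w -> w * w + t * t = cst (K * K) -> (nrm w <= K)%R.
Proof.
intros HK St Sw H.
assert (E : star (w + im * t) = w - im * t) by (rewrite star_add, star_mul, star_im, St, Sw; ring).
assert (Hu : (nrm (w + im * t) <= K)%R).
{ apply nrm_of_isometry; [assumption|]. rewrite E, <- H.
  transitivity (w * w - (im * im) * (t * t)); [ring|]. rewrite im_sq. ring. }
assert (Ew : w = cst (/ 2) * ((w + im * t) + star (w + im * t))).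
{ rewrite E. transitivity ((cst (/ 2) + cst (/ 2)) * w); [rewrite half_half|]; ring. }
rewrite Ew, nrm_cstM, Rabs_right by lra.
generalize (nrm_triangle B (w + im * t) (star (w + im * t))). rewrite (nrm_star B (w + im * t)). lra.
Qed.

Lemma selfadj_cst (r : R) : selfadj B (cst r).
Proof. apply star_cst. Qed.

Lemma selfadjD x y : selfadj B x -> selfadj B y -> selfadj B (x + y).
Proof. unfold selfadj. intros Hx Hy. now rewrite star_add, Hx, Hy. Qed.

Lemma selfadjN x : selfadj B x -> selfadj B (- x).
Proof. unfold selfadj. intros Hx. now rewrite starN, Hx. Qed.

Lemma selfadjB x y : selfadj B x -> selfadj B y -> selfadj B (x - y).
Proof. unfold selfadj. intros Hx Hy. now rewrite starB, Hx, Hy. Qed.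

Lemma selfadjM x y : selfadj B x -> selfadj B y -> selfadj B (x * y).
Proof. unfold selfadj. intros Hx Hy. now rewrite star_mul, Hx, Hy, comm. Qed.

Lemma selfadj0 : selfadj B 0.
Proof. apply star0. Qed.

Lemma selfadj1 : selfadj B 1.
Proof. apply star1. Qed.

Lemma selfadj_star_mul x : selfadj B (star x * x).
Proof. unfold selfadj. now rewrite star_mul, star_star. Qed.

Hint Resolve selfadj_cst selfadjD selfadjN selfadjB selfadjM selfadj0 selfadj1 selfadj_star_mul : selfadj.

Lemma is_square_selfadj a : is_square a -> selfadj B a.
Proof. intros [s [Ss ->]]. auto with selfadj. Qed.
Hint Resolve is_square_selfadj : selfadj.

Lemma is_square_cst (r : R) : (0 <= r)%R -> is_square (cst r).
Proof.
intro Hr. exists (cst (sqrt r)). split; [auto with selfadj|].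
now rewrite <- cstM, sqrt_sqrt.
Qed.

Lemma is_square0 : is_square 0.
Proof. exists 0. split; [auto with selfadj|ring]. Qed.

Lemma is_squareM a b : is_square a -> is_square b -> is_square (a * b).
Proof.
intros [s [Ss ->]] [t [St ->]]. exists (s * t). split; [auto with selfadj|ring].
Qed.

Lemma is_square_cst_sub (r : R) x : (nrm x <= r)%R -> selfadj B x -> is_square (cst r - x).
Proof.
intros Hx Sx. assert (Hx0 := nrm_ge0 B x). destruct (Req_dec r 0) as [->|Hr].
- replace x with (0 : B).
  + rewrite cst0. replace (0 - 0) with (0 : B) by ring. apply is_square0.
  + symmetry. apply nrm_eq0. lra.
- destruct (exists_sqrt_1_sub (cst (/ r) * x)) as [y [Sy [_ Hy]]].
  + rewrite nrm_cstM, Rabs_right.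
    * apply Rmult_le_reg_l with r; [lra|]. rewrite <- Rmult_assoc, Rinv_r; lra.
    * apply Rle_ge, Rlt_le, Rinv_0_lt_compat. lra.
  + auto with selfadj.
  + exists (cst (sqrt r) * (1 - y)). split; [auto with selfadj|].
    transitivity (cst (sqrt r) * cst (sqrt r) * ((1 - y) * (1 - y))); [|ring].
    rewrite Hy, <- cstM, sqrt_sqrt by lra.
    transitivity (cst r - (cst r * cst (/ r)) * x); [|ring].
    rewrite <- cstM, Rinv_r, cst1 by assumption. ring.
Qed.

(** The triangle inequality would only give [2 K]. But [K - s^2] is itself a square [w^2], and
    [w^2 + s^2 = K] bounds the norm of [w] by [sqrt K]. *)
Lemma nrm_cst_sub_square (K : R) s : selfadj B s -> (nrm (s * s) <= K)%R ->
  (nrm (cst K - s * s) <= K)%R.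
Proof.
intros Ss Hs.
assert (HK : (0 <= K)%R) by (generalize (nrm_ge0 B (s * s)); lra).
destruct (is_square_cst_sub K (s * s) Hs) as [w [Sw Hw]]; [auto with selfadj|].
rewrite Hw.
assert (Nw : (nrm w <= sqrt K)%R).
{ apply nrm_le_of_sum_squares with s; auto using sqrt_pos.
  rewrite <- Hw, sqrt_sqrt by assumption. ring. }
eapply Rle_trans; [apply nrm_submul|].
rewrite <- (sqrt_sqrt K) by assumption. apply Rmult_le_compat; auto using nrm_ge0.
Qed.

(** A square lies within some [K] of the constant [K]; such bounds add up, and conversely they make
    a selfadjoint element a square. *)
Lemma is_squareD a b : is_square a -> is_square b -> is_square (a + b).
Proof.
intros Ha Hb. destruct Ha as [s [Ss ->]], Hb as [t [St ->]].
replace (s * s + t * t) with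
  (cst (nrm (s * s) + nrm (t * t)) - ((cst (nrm (s * s)) - s * s) + (cst (nrm (t * t)) - t * t)))
  by (rewrite cstD; ring).
apply is_square_cst_sub; [|auto 6 with selfadj].
eapply Rle_trans; [apply nrm_triangle|]. apply Rplus_le_compat; apply nrm_cst_sub_square; auto; lra.
Qed.

Lemma inverse_selfadj x y : selfadj B x -> x * y = 1 -> selfadj B y.
Proof.
intros Sx H. assert (H' : x * star y = 1).
{ rewrite <- Sx, <- star_mul, comm, H. apply star1. }
unfold selfadj. transitivity (star y * (x * y)); [rewrite H; ring|].
transitivity ((x * star y) * y); [ring|]. rewrite H'. ring.
Qed.

(** [1 + s^2 = (1 + K) (1 - x)] with [x = (K - s^2) / (1 + K)], whose norm is at most
    [K / (1 + K) < 1]. *)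
Lemma invertible_1_add_square n : is_square n -> exists y, (1 + n) * y = 1.
Proof.
intros [s [Ss ->]]. set (K := nrm (s * s)).
assert (HK : (0 <= K)%R) by apply nrm_ge0.
assert (Hd : (0 < / (1 + K))%R) by (apply Rinv_0_lt_compat; lra).
destruct (invertible_1_sub (cst (/ (1 + K)) * (cst K - s * s)) (/ (1 + K) * K)) as [y Hy].
- rewrite nrm_cstM, Rabs_right by lra.
  apply Rmult_le_compat_l; [lra|]. apply nrm_cst_sub_square; auto; apply Rle_refl.
- apply Rmult_lt_reg_l with (1 + K)%R; [lra|]. rewrite <- Rmult_assoc, Rinv_r; lra.
- exists (cst (/ (1 + K)) * y). etransitivity; [|exact Hy].
  assert (E : cst (/ (1 + K)) * cst K = 1 - cst (/ (1 + K)) :> B).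
  { rewrite <- cstM, <- cst1, <- cstB. f_equal. field. lra. }
  transitivity ((cst (/ (1 + K)) + cst (/ (1 + K)) * (s * s)) * y); [ring|].
  transitivity ((1 - cst (/ (1 + K)) * cst K + cst (/ (1 + K)) * (s * s)) * y); [|ring].
  rewrite E. ring.
Qed.


(** The element is [d / (d + b^2)], which is 1 where [b] vanishes and small where [b^2] is large
    against [d]. The equation is free of inverses, so it can be read in any larger algebra. *)
Lemma exists_resolvent b (d : R) : (0 < d)%R -> selfadj B b ->
  exists f, selfadj B f /\ f * (b * b) = cst d * (1 - f).
Proof.
intros Hd Sb.
assert (Sq : is_square (cst (/ d) * (b * b))).
{ apply is_squareM; [|now exists b]. apply is_square_cst, Rlt_le, Rinv_0_lt_compat, Hd. }
destruct (invertible_1_add_square _ Sq) as [f Hf]. exists f. split.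
- apply inverse_selfadj with (1 + cst (/ d) * (b * b)); auto with selfadj.
- assert (Ed : cst d * cst (/ d) = 1 :> B) by (rewrite <- cstM, Rinv_r, cst1; [reflexivity|lra]).
  transitivity ((cst d * cst (/ d)) * (f * (b * b))); [rewrite Ed; ring|].
  transitivity (cst d * ((1 + cst (/ d) * (b * b)) * f - f)); [ring|]. now rewrite Hf.
Qed.

(** * Characters from preorderings *)

Definition preordering (P : B -> Prop) : Prop :=
  (forall x, P x -> selfadj B x) /\
  (forall x, is_square x -> P x) /\
  (forall x y, P x -> P y -> P (x + y)) /\
  (forall x y, P x -> P y -> P (x * y)).

Definition proper_preordering (P : B -> Prop) : Prop := preordering P /\ ~ P (opp 1).

(** [Zorn_bigcup] asks for the union of every chain, the empty one included. The property is
    therefore imposed on the union of [P0] and [X], so that the empty chain yields [P0] itself. *)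
Lemma exists_maximal_preordering P0 : proper_preordering P0 ->
  exists P, proper_preordering P /\ (forall x, P0 x -> P x) /\
    forall Q, proper_preordering Q -> (forall x, P x -> Q x) -> forall x, Q x -> P x.
Proof.
intros H0.
destruct (@classical_sets.Zorn_bigcup B (fun X => proper_preordering (fun x => P0 x \/ X x)))
  as [X [HX Xmax]].
- intros F HF Ftot.
  assert (Hpair : forall x y,
    (P0 x \/ classical_sets.bigcup F (fun X : B -> Prop => X) x) ->
    (P0 y \/ classical_sets.bigcup F (fun X : B -> Prop => X) y) ->
    (P0 x /\ P0 y) \/ exists X, F X /\ (P0 x \/ X x) /\ (P0 y \/ X y)).
  { intros x y [Px|[X FX Xx]] [Py|[Y FY Yy]].
    - now left.
    - right. exists Y. tauto.
    - right. exists X. tauto.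
    - right. destruct (Ftot _ _ FX FY) as [S|S].
      + exists Y. split; [assumption|]. split; right; [apply S|]; assumption.
      + exists X. split; [assumption|]. split; right; [|apply S]; assumption. }
  assert (Hone : forall x, (P0 x \/ classical_sets.bigcup F (fun X : B -> Prop => X) x) ->
    P0 x \/ exists X, F X /\ (P0 x \/ X x)).
  { intros x Hx. destruct (Hpair x x Hx Hx) as [[]|[X [FX []]]]; [now left|right; now exists X]. }
  destruct H0 as [[H1 [H2 [H3 H4]]] H5].
  split; [split; [|split; [|split]]|].
  + intros x Hx. destruct (Hone x Hx) as [Px|[X [FX Xx]]]; [now apply H1|].
    now apply (proj1 (proj1 (HF X FX))).
  + intros x Hx. left. now apply H2.
  + intros x y Hx Hy. destruct (Hpair x y Hx Hy) as [[Px Py]|[X [FX [Xx Xy]]]].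
    * left. now apply H3.
    * destruct (HF X FX) as [[_ [_ [HA _]]] _]. destruct (HA x y Xx Xy); [now left|].
      right. now exists X.
  + intros x y Hx Hy. destruct (Hpair x y Hx Hy) as [[Px Py]|[X [FX [Xx Xy]]]].
    * left. now apply H4.
    * destruct (HF X FX) as [[_ [_ [_ HM]]] _]. destruct (HM x y Xx Xy); [now left|].
      right. now exists X.
  + intro Hx. destruct (Hone _ Hx) as [Px|[X [FX Xx]]]; [now apply H5|].
    now apply (proj2 (HF X FX)).
- exists (fun x => P0 x \/ X x). split; [assumption|]. split; [now left|].
  intros Q HQ Hle x Qx. right. apply NNPP. intro Xx. apply (Xmax Q).
  + split.
    * intros y Xy. apply Hle. now right.
    * intro Hsub. apply Xx. now apply Hsub.
  + replace (fun x => P0 x \/ Q x) with Q; [assumption|].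
    apply functional_extensionality. intro y. apply propositional_extensionality.
    split; [now right|]. intros [Py|]; [|assumption]. apply Hle. now left.
Qed.

(** For [a] outside [P], the preordering [P + a P] is strictly larger than [P], so by maximality it
    contains [-1]. This cannot happen for both [a] and [- a]. *)
Lemma maximal_preordering_total P : proper_preordering P ->
  (forall Q, proper_preordering Q -> (forall x, P x -> Q x) -> forall x, Q x -> P x) ->
  forall a, selfadj B a -> P a \/ P (- a).
Proof.
intros [[H1 [H2 [H3 H4]]] H5] Hmax.
assert (P1 : P 1) by (rewrite <- cst1; apply H2, is_square_cst; lra).
assert (P0 : P 0) by (apply H2, is_square0).
assert (Hadj : forall a, selfadj B a -> P a \/ exists p q, P p /\ P q /\ opp 1 = p + a * q).
{ intros a Sa. destruct (classic (P a)) as [|Hn]; [now left|right].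
  set (Q := fun x => exists p q, P p /\ P q /\ x = p + a * q).
  apply NNPP. intro HQ. apply Hn. apply (Hmax Q).
  - split; [split; [|split; [|split]]|].
    + intros x [p [q [Pp [Pq ->]]]]. auto with selfadj.
    + intros x Hx. exists x, 0. split; [auto|]. split; [auto|ring].
    + intros x y [p [q [Pp [Pq ->]]]] [p' [q' [Pp' [Pq' ->]]]].
      exists (p + p'), (q + q'). split; [auto|]. split; [auto|ring].
    + intros x y [p [q [Pp [Pq ->]]]] [p' [q' [Pp' [Pq' ->]]]].
      exists (p * p' + (a * a) * (q * q')), (p * q' + q * p').
      assert (P (a * a)) by (apply H2; now exists a).
      split; [auto|]. split; [auto|ring].
    + assumption.
  - intros x Px. exists x, 0. split; [auto|]. split; [auto|ring].
  - exists 0, 1. split; [auto|]. split; [auto|ring]. }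
intros a Sa. destruct (Hadj a Sa) as [|[p [q [Pp [Pq E]]]]]; [now left|].
destruct (Hadj (- a)) as [|[p' [q' [Pp' [Pq' E']]]]]; [auto with selfadj|now right|].
exfalso. apply H5.
assert (Paa : P (a * a)) by (apply H2; now exists a).
(* Multiplying [a q = - (1 + p)] by [- a q' = - (1 + p')]. *)
replace (opp 1) with (p + p' + p * p' + (a * a) * (q * q')); [auto 6|].
assert (E1 : a * q = opp 1 - p) by (rewrite E; ring).
assert (E2 : a * q' = 1 + p') by (transitivity (p' - (p' + - a * q')); [ring|rewrite <- E'; ring]).
transitivity (p + p' + p * p' + (a * q) * (a * q')); [ring|]. rewrite E1, E2. ring.
Qed.

(** * The character cut out by a total preordering *)

Section State.
Variable P : B -> Prop.
Hypothesis HP : proper_preordering P.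
Hypothesis Ptotal : forall a, selfadj B a -> P a \/ P (- a).

Let P_sq x : is_square x -> P x.
Proof. apply HP. Qed.
Let P_add x y : P x -> P y -> P (x + y).
Proof. apply HP. Qed.
Let P_mul x y : P x -> P y -> P (x * y).
Proof. apply HP. Qed.

Lemma preordering_cst r : (0 <= r)%R -> P (cst r).
Proof. intro. now apply P_sq, is_square_cst. Qed.

Lemma preordering_cst_inv r : P (cst r) -> (0 <= r)%R.
Proof.
intro H. apply Rnot_lt_le. intro Hr. apply (proj2 HP).
replace (opp 1) with (@cst B r * cst (/ - r)).
- apply P_mul; [assumption|]. apply preordering_cst, Rlt_le, Rinv_0_lt_compat. lra.
- rewrite <- cstM, <- cst1, <- cstN. f_equal. field. lra.
Qed.

Lemma preordering_cst_le a r t : (r <= t)%R -> P (a - cst t) -> P (a - cst r).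
Proof.
intros H Pa. replace (a - cst r) with (a - cst t + cst (t - r)).
- apply P_add; [assumption|]. apply preordering_cst. lra.
- rewrite cstB. ring.
Qed.

(** A Dedekind cut with margins: [P] is not assumed closed, so nothing is claimed at [t] itself. *)
Definition is_value a (t : R) : Prop :=
  forall eps, (eps > 0)%R -> P (a - cst (t - eps)) /\ P (cst (t + eps) - a).

(** [nrm a - a] and [nrm a + a] are squares, so the lower half of the cut is bounded and nonempty;
    totality puts the other half into [P]. *)
Lemma is_value_exists a : selfadj B a -> exists t, is_value a t.
Proof.
intro Sa. set (E := fun r => P (a - cst r)).
assert (Hub : P (cst (nrm a) - a)).
{ apply P_sq, is_square_cst_sub; [apply Rle_refl|assumption]. }
destruct (completeness E) as [t [Ht Hl]].
- exists (nrm a). intros r Er. unfold E in Er.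
  assert (0 <= nrm a - r)%R; [|lra]. apply preordering_cst_inv. rewrite cstB.
  replace (cst (nrm a) - cst r) with (cst (nrm a) - a + (a - cst r)) by ring. auto.
- exists (- nrm a)%R. unfold E. rewrite cstN.
  replace (a - - cst (nrm a)) with (cst (nrm a) - - a) by ring.
  apply P_sq, is_square_cst_sub; [rewrite nrmN; apply Rle_refl|auto with selfadj].
- exists t. intros eps He. split.
  + apply NNPP. intro Hn. assert (t <= t - eps)%R; [|lra]. apply Hl.
    intros r Er. apply Rnot_lt_le. intro Hr. apply Hn.
    apply preordering_cst_le with r; [lra|assumption].
  + destruct (Ptotal (a - cst (t + eps))) as [H|H]; [auto with selfadj| |].
    * exfalso. generalize (Ht _ H). lra.
    * now replace (cst (t + eps) - a) with (- (a - cst (t + eps))) by ring.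
Qed.

Lemma is_value_unique a r t : is_value a r -> is_value a t -> r = t.
Proof.
assert (H : forall r t, is_value a r -> is_value a t -> (r <= t)%R).
{ clear r t. intros r t Hr Ht. apply Rnot_lt_le. intro Hlt.
  destruct (Hr ((r - t) / 4)%R) as [H1 _]; [lra|]. destruct (Ht ((r - t) / 4)%R) as [_ H2]; [lra|].
  generalize (P_add _ _ H1 H2).
  replace (a - cst (r - (r - t) / 4) + (cst (t + (r - t) / 4) - a)) with
    (@cst B ((t + (r - t) / 4) - (r - (r - t) / 4))) by (rewrite cstB; ring).
  intro Hc. apply preordering_cst_inv in Hc. lra. }
intros Hr Ht. apply Rle_antisym; auto.
Qed.

Lemma is_valueD a b r t : is_value a r -> is_value b t -> is_value (a + b) (r + t).
Proof.
intros Ha Hb eps He. destruct (Ha (eps / 2)%R) as [A1 A2]; [lra|].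
destruct (Hb (eps / 2)%R) as [B1 B2]; [lra|]. split.
- replace (a + b - cst (r + t - eps)) with (a - cst (r - eps / 2) + (b - cst (t - eps / 2))); auto.
  replace (r + t - eps)%R with ((r - eps / 2) + (t - eps / 2))%R by lra. rewrite cstD. ring.
- replace (cst (r + t + eps) - (a + b)) with (cst (r + eps / 2) - a + (cst (t + eps / 2) - b)); auto.
  replace (r + t + eps)%R with ((r + eps / 2) + (t + eps / 2))%R by lra. rewrite !cstD. ring.
Qed.

Lemma is_value_cst r : is_value (cst r) r.
Proof.
intros eps He. rewrite <- !cstB. split; apply preordering_cst; lra.
Qed.

Lemma is_value_nonneg a t : P a -> is_value a t -> (0 <= t)%R.
Proof.
intros Pa Ha. apply Rnot_lt_le. intro Ht. destruct (Ha (- t / 2)%R) as [_ H]; [lra|].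
generalize (P_add _ _ Pa H). replace (a + (cst (t + - t / 2) - a)) with (@cst B (t + - t / 2)) by ring.
intro Hc. apply preordering_cst_inv in Hc. lra.
Qed.

(* [2 (M e - a b) = (M + a) (e - b) + (M - a) (e + b)] *)
Lemma is_valueM0 a b : selfadj B a -> is_value b 0 -> is_value (a * b) 0.
Proof.
intros Sa Hb.
assert (Key : forall a, selfadj B a -> forall eps, (eps > 0)%R -> P (cst eps - a * b)).
{ clear a Sa. intros a Sa eps He. set (M := (nrm a + 1)%R).
  assert (HM : (M > 0)%R) by (unfold M; generalize (nrm_ge0 B a); lra).
  destruct (Hb (eps / M)%R) as [B1 B2]; [now apply Rdiv_lt_0_compat|].
  assert (Hp : P (cst M + a)).
  { replace (cst M + a) with (cst M - - a) by ring.
    apply P_sq, is_square_cst_sub; [rewrite nrmN; unfold M; lra|auto with selfadj]. }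
  assert (Hm : P (cst M - a)).
  { apply P_sq, is_square_cst_sub; [unfold M; lra|assumption]. }
  replace (cst eps - a * b) with (cst (/ 2) *
    ((cst M + a) * (cst (0 + eps / M) - b) + (cst M - a) * (b - cst (0 - eps / M)))).
  - apply P_mul; [apply preordering_cst; lra|auto].
  - replace (cst eps) with (@cst B M * cst (eps / M)).
    + rewrite cstD, cstB, cst0.
      transitivity ((cst (/ 2) + cst (/ 2)) * (cst M * cst (eps / M) - a * b)); [ring|].
      rewrite half_half. ring.
    + rewrite <- cstM. f_equal. field. lra. }
intros eps He. split.
- replace (a * b - cst (0 - eps)) with (cst eps - - a * b).
  + apply Key; auto with selfadj.
  + rewrite cstB, cst0. ring.
- rewrite Rplus_0_l. now apply Key.
Qed.

Definition value a : R := epsilon (inhabits 0%R) (is_value a).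

Lemma valueP a : selfadj B a -> is_value a (value a).
Proof. intro Sa. unfold value. apply epsilon_spec. now apply is_value_exists. Qed.

Lemma value_eq a t : selfadj B a -> is_value a t -> value a = t.
Proof. intros Sa Ha. apply is_value_unique with a; [now apply valueP|assumption]. Qed.

Lemma valueD a b : selfadj B a -> selfadj B b -> value (a + b) = (value a + value b)%R.
Proof. intros Sa Sb. apply value_eq; auto using valueP, is_valueD with selfadj. Qed.

Lemma value_cst r : value (cst r) = r.
Proof. apply value_eq; [auto with selfadj|apply is_value_cst]. Qed.

Lemma valueN a : selfadj B a -> value (- a) = (- value a)%R.
Proof.
intro Sa. assert (H : value (a + - a) = 0%R) by (rewrite addN, <- (value_cst 0), cst0; reflexivity).
rewrite valueD in H by auto with selfadj. lra.
Qed.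

Lemma valueB a b : selfadj B a -> selfadj B b -> value (a - b) = (value a - value b)%R.
Proof. intros Sa Sb. unfold sub. rewrite valueD, valueN by auto with selfadj. reflexivity. Qed.

Lemma value_mul0 a b : selfadj B a -> selfadj B b -> value b = 0%R -> value (a * b) = 0%R.
Proof.
intros Sa Sb Hb. apply value_eq; [auto with selfadj|]. apply is_valueM0; [assumption|].
rewrite <- Hb. now apply valueP.
Qed.

(** Subtracting from [b] and [a] their values leaves products with a factor of value 0, which have
    value 0. *)
Lemma valueM a b : selfadj B a -> selfadj B b -> value (a * b) = (value a * value b)%R.
Proof.
intros Sa Sb.
assert (H1 : value (a * (b - cst (value b))) = 0%R).
{ apply value_mul0; [auto with selfadj..|]. rewrite valueB, value_cst by auto with selfadj. lra. }
assert (H2 : value (cst (value b) * (a - cst (value a))) = 0%R).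
{ apply value_mul0; [auto with selfadj..|]. rewrite valueB, value_cst by auto with selfadj. lra. }
replace (a * b) with
  (a * (b - cst (value b)) + cst (value b) * (a - cst (value a)) + cst (value a * value b)).
- rewrite valueD, valueD, H1, H2, value_cst by auto 6 with selfadj. lra.
- rewrite cstM. ring.
Qed.

Definition re x : B := cst (/ 2) * (x + star x).
(** [(x - star x) / (2 i)], with [1 / i = - i] absorbed into the order of the difference. *)
Definition impart x : B := cst (/ 2) * (im * (star x - x)).

Lemma selfadj_re x : selfadj B (re x).
Proof. unfold selfadj, re. rewrite star_mul, star_add, star_star, star_cst. ring. Qed.

Lemma selfadj_impart x : selfadj B (impart x).
Proof. unfold selfadj, impart. rewrite !star_mul, starB, star_star, star_cst, star_im. ring. Qed.

Lemma re_impart x : x = re x + im * impart x.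
Proof.
unfold re, impart.
transitivity (cst (/ 2) * (x + star x) + cst (/ 2) * ((im * im) * (star x - x))); [|ring].
rewrite im_sq. transitivity ((cst (/ 2) + cst (/ 2)) * x); [rewrite half_half|]; ring.
Qed.

Lemma re_cartesian h k : selfadj B h -> selfadj B k -> re (h + im * k) = h.
Proof.
intros Sh Sk. unfold re. rewrite star_add, star_mul, star_im, Sh, Sk.
transitivity ((cst (/ 2) + cst (/ 2)) * h); [|rewrite half_half]; ring.
Qed.

Lemma impart_cartesian h k : selfadj B h -> selfadj B k -> impart (h + im * k) = k.
Proof.
intros Sh Sk. unfold impart. rewrite star_add, star_mul, star_im, Sh, Sk.
transitivity (opp ((cst (/ 2) + cst (/ 2)) * (im * im) * k)); [ring|].
rewrite half_half, im_sq. ring.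
Qed.

Definition cvalue x : Cpx := (value (re x), value (impart x)).

Lemma cvalue_cartesian h k : selfadj B h -> selfadj B k -> cvalue (h + im * k) = (value h, value k).
Proof. intros Sh Sk. unfold cvalue. now rewrite re_cartesian, impart_cartesian. Qed.

Lemma cvalue_selfadj h : selfadj B h -> cvalue h = (value h, 0%R).
Proof.
intro Sh. replace h with (h + im * cst 0) at 1 by (rewrite cst0; ring).
rewrite cvalue_cartesian by auto with selfadj. now rewrite value_cst.
Qed.

Lemma cvalueM x y : cvalue (x * y) = Cmul (cvalue x) (cvalue y).
Proof.
rewrite (re_impart x), (re_impart y).
generalize (selfadj_re x) (selfadj_impart x) (selfadj_re y) (selfadj_impart y).
generalize (re x) (impart x) (re y) (impart y). intros h k h' k' Sh Sk Sh' Sk'.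
replace ((h + im * k) * (h' + im * k')) with ((h * h' - k * k') + im * (h * k' + k * h')).
- rewrite !cvalue_cartesian by auto with selfadj.
  rewrite valueB, valueD, !valueM by auto with selfadj. reflexivity.
- transitivity (h * h' + (opp 1) * (k * k') + im * (h * k' + k * h')); [ring|].
  rewrite <- im_sq. ring.
Qed.

Lemma cvalueD x y : cvalue (x + y) = Cadd (cvalue x) (cvalue y).
Proof.
rewrite (re_impart x), (re_impart y).
generalize (selfadj_re x) (selfadj_impart x) (selfadj_re y) (selfadj_impart y).
generalize (re x) (impart x) (re y) (impart y). intros h k h' k' Sh Sk Sh' Sk'.
replace (h + im * k + (h' + im * k')) with ((h + h') + im * (k + k')) by ring.
rewrite !cvalue_cartesian, !valueD by auto with selfadj. reflexivity.
Qed.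

Lemma scal_cartesian (z : Cpx) x : scal z x = (cst (fst z) + im * cst (snd z)) * x.
Proof.
unfold im. rewrite <- (scal_mull B (0, 1)%R), mul1l. unfold cst.
rewrite scalA, <- scalDl, <- scal_mull, mul1l. f_equal.
destruct z; unfold Cadd, Cmul; simpl; f_equal; ring.
Qed.

Lemma isChar_cvalue : isChar B (fun _ => True) cvalue.
Proof.
split; [|split; [|split; [|split]]].
- intros x y _ _. apply cvalueD.
- intros z x _. rewrite scal_cartesian, cvalueM, cvalue_cartesian, !value_cst by auto with selfadj.
  now destruct z.
- intros x y _ _. apply cvalueM.
- rewrite cvalue_selfadj by auto with selfadj. rewrite <- cst1, value_cst. reflexivity.
- intros x Hx. now destruct Hx.
Qed.

End State.

(** To obtain a character obeying given inequalities, it suffices to write down a preordering that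
    forces them and to refute [-1]. *)
Lemma exists_char_nonneg P : proper_preordering P ->
  exists l, isChar B (fun _ => True) l /\ forall a, P a -> (0 <= fst (l a))%R.
Proof.
intro HP. destruct (exists_maximal_preordering P HP) as [M [HM [Hle Hmax]]].
assert (Mt := maximal_preordering_total M HM Hmax).
exists (cvalue M). split; [now apply isChar_cvalue|].
intros a Pa. assert (Sa : selfadj B a) by (apply HM; auto).
rewrite (cvalue_selfadj M HM Mt a Sa). simpl.
apply is_value_nonneg with M a; auto. now apply valueP.
Qed.

(** * Gelfand theory of a commutative algebra *)

Definition char (l : B -> Cpx) : Prop := isChar B (fun _ => True) l.

Section Char.
Variable l : B -> Cpx.
Hypothesis Hl : char l.

Lemma charD x y : l (x + y) = Cadd (l x) (l y).
Proof. now apply Hl. Qed.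

Lemma char_scal (z : Cpx) x : l (scal z x) = Cmul z (l x).
Proof. now apply Hl. Qed.

Lemma charM x y : l (x * y) = Cmul (l x) (l y).
Proof. now apply Hl. Qed.

Lemma char1 : l 1 = Cone.
Proof. apply Hl. Qed.

Lemma char_cst (r : R) : l (cst r) = (r, 0%R).
Proof. unfold cst. rewrite char_scal, char1. unfold Cmul, Cone; simpl. f_equal; ring. Qed.

Lemma char0 : l 0 = Czero.
Proof. rewrite <- cst0. apply char_cst. Qed.

Lemma char_re_D x y : fst (l (x + y)) = (fst (l x) + fst (l y))%R.
Proof. now rewrite charD. Qed.

Lemma char_re_B x y : fst (l (x - y)) = (fst (l x) - fst (l y))%R.
Proof.
unfold sub. rewrite char_re_D, oppE, char_scal. simpl. ring.
Qed.

(* If [l a = (r, t)] with [t <> 0], then [b = (a - r) / t] has [l b = i], so [l (1 + b * b) = 0]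
   although [1 + b * b] is invertible. *)
Lemma char_im_selfadj a : selfadj B a -> snd (l a) = 0%R.
Proof.
intro Sa. apply NNPP. intro Ht. set (t := snd (l a)) in *.
set (b := cst (/ t) * (a + cst (- fst (l a)))).
assert (Hb : l b = (0, 1)%R).
{ unfold b. rewrite charM, charD, !char_cst. unfold Cmul, Cadd; simpl. fold t.
  f_equal; field; assumption. }
destruct (invertible_1_add_square (b * b)) as [y Hy].
{ exists b. split; [unfold b; auto with selfadj|reflexivity]. }
assert (E : l ((1 + b * b) * y) = Cone) by (rewrite Hy; apply char1).
rewrite charM, charD, charM, char1, Hb in E. unfold Cmul, Cadd, Cone in E; simpl in E.
injection E. intros. lra.
Qed.

Lemma char_selfadj a : selfadj B a -> l a = (fst (l a), 0%R).
Proof. intro Sa. rewrite <- (char_im_selfadj a Sa). now destruct (l a). Qed.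

Lemma char_re_M x y : selfadj B x -> fst (l (x * y)) = (fst (l x) * fst (l y))%R.
Proof. intro Sx. rewrite charM. simpl. rewrite (char_im_selfadj x Sx). ring. Qed.

Lemma char_square_nonneg a : is_square a -> (0 <= fst (l a))%R.
Proof. intros [s [Ss ->]]. rewrite char_re_M by assumption. nra. Qed.

Lemma char_le_nrm a (r : R) : selfadj B a -> (nrm a <= r)%R -> (- r <= fst (l a) <= r)%R.
Proof.
intros Sa Ha.
assert (H1 := char_square_nonneg _ (is_square_cst_sub r a Ha Sa)).
assert (H2 : is_square (cst r - - a)).
{ apply is_square_cst_sub; [now rewrite nrmN|auto with selfadj]. }
apply char_square_nonneg in H2.
replace (cst r - - a) with (cst r + a) in H2 by ring.
rewrite char_re_B, char_cst in H1. rewrite char_re_D, char_cst in H2. simpl in *. lra.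
Qed.

Lemma char_star x : l (star x) = Cconj (l x).
Proof.
assert (E : star x = re x - im * impart x).
{ rewrite (re_impart x) at 1.
  rewrite star_add, star_mul, star_im, selfadj_re, selfadj_impart. ring. }
assert (Him : l im = (0, 1)%R).
{ unfold im. rewrite char_scal, char1. unfold Cmul; simpl. f_equal; ring. }
assert (Ex : l x = l (re x + im * impart x)) by now rewrite <- re_impart.
rewrite E, Ex. unfold sub.
rewrite !charD, oppE, char_scal, charM, Him.
rewrite (char_selfadj _ (selfadj_re x)), (char_selfadj _ (selfadj_impart x)).
unfold Cmul, Cadd, Cconj; simpl. f_equal; ring.
Qed.

End Char.

(** [P] is the cone of squares modulo the ideal of [h = star x * x]. It contains [h] and [- h], so a
    character nonnegative on it kills [h], hence [x]. If [-1] were in [P], then [h k = 1 + n] for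
    some [k] and a square [n]; this is invertible, and so would be [x]. *)
Lemma exists_char_of_noninvertible x : ~ (exists y, x * y = 1) -> exists l, char l /\ l x = Czero.
Proof.
intro Hx. set (h := star x * x).
assert (Sh : selfadj B h) by (unfold h; auto with selfadj).
set (P := fun p => selfadj B p /\ exists k, selfadj B k /\ is_square (p + h * k)).
assert (Hh : forall r, P (cst r * h)).
{ intro r. split; [auto with selfadj|]. exists (cst (- r)). split; [auto with selfadj|].
  replace (cst r * h + h * cst (- r)) with (0 : B); [apply is_square0|]. rewrite cstN. ring. }
destruct (exists_char_nonneg P) as [l [Hl Hpos]].
- split; [split; [|split; [|split]]|].
  + now intros p [].
  + intros p Hp. split; [auto with selfadj|]. exists 0. split; [auto with selfadj|].
    now replace (p + h * 0) with p by ring.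
  + intros p p' [Sp [k [Sk Hk]]] [Sp' [k' [Sk' Hk']]]. split; [auto with selfadj|].
    exists (k + k'). split; [auto with selfadj|].
    replace (p + p' + h * (k + k')) with ((p + h * k) + (p' + h * k')) by ring. now apply is_squareD.
  + intros p p' [Sp [k [Sk Hk]]] [Sp' [k' [Sk' Hk']]]. split; [auto with selfadj|].
    exists (p * k' + p' * k + h * k * k'). split; [auto 6 with selfadj|].
    replace (p * p' + h * (p * k' + p' * k + h * k * k')) with ((p + h * k) * (p' + h * k')) by ring.
    now apply is_squareM.
  + intros [_ [k [Sk Hk]]]. apply Hx.
    destruct (invertible_1_add_square _ Hk) as [y Hy]. exists (star x * k * y).
    rewrite <- Hy. unfold h. ring.
- exists l. split; [assumption|].
  assert (E : fst (l h) = 0%R).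
  { generalize (Hpos _ (Hh 1%R)) (Hpos _ (Hh (-1)%R)).
    rewrite !(char_re_M l Hl), !(char_cst l Hl) by auto with selfadj. simpl. lra. }
  unfold h in E. rewrite (charM l Hl), (char_star l Hl) in E. unfold Cmul, Cconj in E. simpl in E.
  destruct (l x) as [r t]. simpl in E. unfold Czero. f_equal; nra.
Qed.

(** [P] adjoins [- c] to the squares. A character nonnegative on it would have [l c <= 0], so [-1]
    lies in [P], which is a certificate [c m = 1 + n] with squares [n] and [m]. *)
Lemma is_square_of_char_pos c : selfadj B c -> (forall l, char l -> (0 < fst (l c))%R) -> is_square c.
Proof.
intros Sc Hc.
set (P := fun p => exists n m, is_square n /\ is_square m /\ p = n - c * m).
assert (S1 : is_square 1) by (rewrite <- cst1; apply is_square_cst; lra).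
assert (S0 := is_square0).
destruct (classic (P (opp 1))) as [[n [m [Hn [Hm E]]]]|HP].
- destruct (invertible_1_add_square n Hn) as [y Hy].
  assert (E1 : c * m = 1 + n) by (transitivity (n - (n - c * m)); [ring|rewrite <- E; ring]).
  assert (Sy : selfadj B y) by (apply inverse_selfadj with (1 + n); auto with selfadj).
  (* Since [c m y = 1], [c = c (c m y)^2]; regrouping one [c m] as [1 + n] leaves a product of
     squares. *)
  replace c with ((1 + n) * ((c * y) * (c * y) * m)).
  + apply is_squareM; [now apply is_squareD|]. apply is_squareM; [|assumption].
    exists (c * y). auto with selfadj.
  + rewrite <- E1. transitivity (c * ((c * m) * y) * ((c * m) * y)); [ring|].
    rewrite E1, Hy. ring.
- exfalso. destruct (exists_char_nonneg P) as [l [Hl Hpos]].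
  + split; [split; [|split; [|split]]|assumption].
    * intros p [n [m [Hn [Hm ->]]]]. auto with selfadj.
    * intros p Hp. exists p, 0. split; [auto|]. split; [auto|ring].
    * intros p p' [n [m [Hn [Hm ->]]]] [n' [m' [Hn' [Hm' ->]]]].
      exists (n + n'), (m + m'). split; [now apply is_squareD|]. split; [now apply is_squareD|ring].
    * intros p p' [n [m [Hn [Hm ->]]]] [n' [m' [Hn' [Hm' ->]]]].
      exists (n * n' + (c * c) * (m * m')), (n * m' + n' * m).
      assert (is_square (c * c)) by now exists c.
      split; [auto using is_squareD, is_squareM|]. split; [auto using is_squareD, is_squareM|ring].
  + assert (H : P (0 - c * 1)) by now exists 0, 1.
    apply Hpos in H. specialize (Hc l Hl).
    rewrite (char_re_B l Hl), (char0 l Hl) in H.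
    replace (c * 1) with c in H by ring. simpl in H. lra.
Qed.

(** [eps^2 - x^2] is positive at every character, hence a square [s^2], and [x^2 + s^2 = eps^2]
    bounds the norm of [x] by [eps]. *)
Lemma char_separates x : selfadj B x -> (forall l, char l -> fst (l x) = 0%R) -> x = 0.
Proof.
intros Sx Hx. apply nrm_small with 1%R; [lra|]. intros eps He. rewrite Rmult_1_l.
destruct (is_square_of_char_pos (cst (eps * eps) - x * x)) as [s [Ss E]]; [auto with selfadj| |].
- intros l Hl. rewrite (char_re_B l Hl), (char_re_M l Hl), (char_cst l Hl), (Hx l Hl) by assumption.
  simpl. nra.
- apply nrm_le_of_sum_squares with s; auto; [lra|]. rewrite <- E. ring.
Qed.

(** The element is [(|a| + a) / 2], with [|a| = N (1 - y)] and [1 - y] a root of [b^2] for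
    [b = a / N]. The bound [nrm y <= 1] makes this root nonnegative at every character; the [+ 1] in
    [N] covers [a = 0]. *)
Lemma exists_positive_part a : selfadj B a ->
  exists p, selfadj B p /\ forall l, char l -> fst (l p) = Rmax (fst (l a)) 0.
Proof.
intro Sa. set (N := (nrm a + 1)%R). assert (HN : (0 < N)%R) by (unfold N; generalize (nrm_ge0 B a); lra).
assert (Hd : (0 < / N)%R) by now apply Rinv_0_lt_compat.
set (b := cst (/ N) * a). assert (Sb : selfadj B b) by (unfold b; auto with selfadj).
assert (Nb : (nrm b <= 1)%R).
{ unfold b. rewrite nrm_cstM, Rabs_right by lra. apply Rmult_le_reg_l with N; [assumption|].
  rewrite <- Rmult_assoc, Rinv_r by lra. unfold N. lra. }
assert (Nbb : (nrm (cst 1 - b * b) <= 1)%R).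
{ apply nrm_cst_sub_square; [assumption|]. generalize (nrm_submul B b b) (nrm_ge0 B b). nra. }
rewrite cst1 in Nbb.
destruct (exists_sqrt_1_sub (1 - b * b) Nbb) as [y [Sy [Ny Hy]]]; [auto with selfadj|].
exists (cst (N / 2) * ((1 - y) + b)). split; [auto with selfadj|].
intros l Hl.
assert (E : (fst (l (1 - y)%alg) * fst (l (1 - y)%alg) = fst (l b) * fst (l b))%R).
{ rewrite <- !(char_re_M l Hl) by auto with selfadj. rewrite Hy. do 2 f_equal. ring. }
assert (Eb : fst (l a) = (N * fst (l b))%R).
{ unfold b. rewrite (char_re_M l Hl), (char_cst l Hl) by auto with selfadj. simpl. field. lra. }
assert (Hyl := char_le_nrm l Hl y 1 Sy Ny).
rewrite (char_re_M l Hl), (char_re_D l Hl), (char_cst l Hl), Eb by auto with selfadj.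
rewrite (char_re_B l Hl), (char1 l Hl) in *. simpl in *.
set (u := fst (l b)) in *. set (v := fst (l y)) in *.
assert (Hv : ((1 - v) - u = 0 \/ (1 - v) + u = 0)%R) by (apply Rmult_integral; lra).
destruct (Rle_dec 0 u).
- rewrite Rmax_left by nra. destruct Hv; [replace (1 - v)%R with u by lra|]; nra.
- rewrite Rmax_right by nra. destruct Hv; [lra|]. nra.
Qed.

(** The base value 0 matches [bigsup], whose join starts at [zr]. *)
Definition char_max (l : B -> Cpx) (L : list B) : R :=
  fold_right (fun u r => Rmax (fst (l u)) r) 0%R L.

Lemma char_max_nonneg l L : (0 <= char_max l L)%R.
Proof. induction L; simpl; [lra|]. eapply Rle_trans; [eassumption|apply Rmax_r]. Qed.

Lemma char_max_app l L L' : char_max l (L ++ L') = Rmax (char_max l L) (char_max l L').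
Proof.
induction L as [|u L IH]; simpl.
- symmetry. apply Rmax_right, char_max_nonneg.
- now rewrite IH, Rmax_assoc.
Qed.

(* Otherwise the elements that, on [{l | q <= l a}], are bounded below by a multiple of some
   [- max L] form a proper preordering, and a character nonnegative on it contradicts the
   hypothesis, since the preordering contains [a - q] and all [- u]. *)
Lemma char_compact a (q : R) (U : B -> Prop) : selfadj B a ->
  (forall u, U u -> selfadj B u) ->
  (forall l, char l -> (q <= fst (l a))%R -> exists u, U u /\ (0 < fst (l u))%R) ->
  exists L K, (forall u, In u L -> U u) /\ (0 <= K)%R /\
    forall l, char l -> (q <= fst (l a))%R -> (1 <= K * char_max l L)%R.
Proof.
intros Sa SU HU.
set (P := fun p => selfadj B p /\ exists L K, (forall u, In u L -> U u) /\ (0 <= K)%R /\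
    forall l, char l -> (q <= fst (l a))%R -> (0 <= fst (l p) + K * char_max l L)%R).
destruct (classic (P (opp 1))) as [[_ [L [K [HL [HK H]]]]]|HP].
{ exists L, K. split; [assumption|]. split; [assumption|]. intros l Hl Hq.
  specialize (H l Hl Hq). rewrite oppE, (char_scal l Hl), (char1 l Hl) in H. simpl in H. lra. }
exfalso. destruct (exists_char_nonneg P) as [l [Hl Hpos]].
- split; [split; [|split; [|split]]|assumption].
  + now intros x [].
  + intros x Hx. split; [auto with selfadj|]. exists nil, 0%R. split; [now intros u []|].
    split; [lra|]. intros l Hl _. generalize (char_square_nonneg l Hl x Hx). lra.
  + intros x x' [Sx [L [K [HL [HK H]]]]] [Sx' [L' [K' [HL' [HK' H']]]]].
    split; [auto with selfadj|]. exists (L ++ L'), (K + K')%R.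
    split; [intros u Hu; apply in_app_or in Hu; destruct Hu; auto|]. split; [lra|].
    intros l Hl Hq. specialize (H l Hl Hq). specialize (H' l Hl Hq).
    rewrite char_max_app, (char_re_D l Hl).
    generalize (Rmax_l (char_max l L) (char_max l L')) (Rmax_r (char_max l L) (char_max l L')).
    nra.
  + intros x x' [Sx [L [K [HL [HK H]]]]] [Sx' [L' [K' [HL' [HK' H']]]]].
    (* The product is negative at a character only if exactly one factor is; that factor is bounded
       below by [- K m] or [- K' m], and the other one above by its norm. *)
    split; [auto with selfadj|]. exists (L ++ L'), (K * nrm x' + K' * nrm x)%R.
    assert (Nx := nrm_ge0 B x). assert (Nx' := nrm_ge0 B x').
    split; [intros u Hu; apply in_app_or in Hu; destruct Hu; auto|]. split; [nra|].
    intros l Hl Hq. specialize (H l Hl Hq). specialize (H' l Hl Hq).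
    rewrite char_max_app, (char_re_M l Hl) by assumption.
    assert (Bx := char_le_nrm l Hl x _ Sx (Rle_refl _)).
    assert (Bx' := char_le_nrm l Hl x' _ Sx' (Rle_refl _)).
    assert (M := Rmax_l (char_max l L) (char_max l L')).
    assert (M' := Rmax_r (char_max l L) (char_max l L')).
    assert (M0 := char_max_nonneg l L). assert (M0' := char_max_nonneg l L').
    set (m := Rmax _ _) in *. set (r := fst (l x)) in *. set (r' := fst (l x')) in *.
    assert (E : (0 <= r + K * m)%R) by nra. assert (E' : (0 <= r' + K' * m)%R) by nra.
    assert (Km : (0 <= K * m)%R) by nra. assert (Km' : (0 <= K' * m)%R) by nra.
    destruct (Rle_dec 0 r); destruct (Rle_dec 0 r'); nra.
- assert (Ha : P (a - cst q)).
    { split; [auto with selfadj|]. exists nil, 0%R. split; [now intros u []|].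
      split; [lra|]. intros l' Hl' Hq. rewrite (char_re_B l' Hl'), (char_cst l' Hl'). simpl. lra. }
    apply Hpos in Ha. rewrite (char_re_B l Hl), (char_cst l Hl) in Ha. simpl in Ha.
    destruct (HU l Hl) as [u [Uu Hu]]; [lra|].
    assert (H : P (0 - u)).
    { split; [auto with selfadj|]. exists (u :: nil), 1%R. split; [now intros v [<-|[]]|].
      split; [lra|]. intros l' Hl' _. rewrite (char_re_B l' Hl'), (char0 l' Hl'). simpl.
      generalize (Rmax_l (fst (l' u)) 0). lra. }
    apply Hpos in H. rewrite (char_re_B l Hl), (char0 l Hl) in H. simpl in H. lra.
Qed.

End Commutative.

(** * Commutative subalgebras *)

#[local] Hint Resolve selfadj_cst selfadjD selfadjN selfadjB selfadjM selfadj0 selfadj1 : selfadj.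

Section Subalgebra.
Variable A : CStarAlg.
Variable S : A -> Prop.
Hypothesis HS : isCommSub A S.
Local Open Scope alg_scope.

Lemma sub_un : S 1.
Proof. apply HS. Qed.
Lemma sub_add x y : S x -> S y -> S (x + y).
Proof. apply HS. Qed.
Lemma sub_mul x y : S x -> S y -> S (x * y).
Proof. apply HS. Qed.
Lemma sub_scal (z : Cpx) x : S x -> S (scal z x).
Proof. apply HS. Qed.
Lemma sub_star x : S x -> S (star x).
Proof. apply HS. Qed.
Lemma sub_comm x y : S x -> S y -> x * y = y * x.
Proof. apply HS. Qed.
Lemma sub_cst (r : R) : S (cst r).
Proof. apply sub_scal, sub_un. Qed.
Lemma sub_zr : S 0.
Proof. rewrite <- cst0. apply sub_cst. Qed.
Lemma sub_opp x : S x -> S (- x).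
Proof. rewrite oppE. apply sub_scal. Qed.
Lemma sub_sub x y : S x -> S y -> S (x - y).
Proof. intros. unfold sub. auto using sub_add, sub_opp. Qed.

Definition subcar : Type := {x : A | S x}.

Lemma subcar_eq (x y : subcar) : proj1_sig x = proj1_sig y -> x = y.
Proof. apply eq_sig_hprop. intros. apply proof_irrelevance. Qed.

Lemma subcar_complete (u : nat -> subcar) :
  (forall eps, eps > 0 -> exists N, forall n m, (n >= N)%nat -> (m >= N)%nat ->
     nrm (proj1_sig (u n) + opp (proj1_sig (u m))) < eps)%R ->
  exists l : subcar, (forall eps, eps > 0 -> exists N, forall n, (n >= N)%nat ->
     nrm (proj1_sig (u n) + opp (proj1_sig l)) < eps)%R.
Proof.
intro H. destruct (complete A _ H) as [l Hl].
assert (Sl : S l) by (apply HS with (fun n => proj1_sig (u n)); [intro n; apply proj2_sig|exact Hl]).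
now exists (exist _ l Sl).
Qed.

(** As a C*-algebra of its own, [S] falls under the commutative theory. The definition is
    transparent, so its operations and norm reduce to those of [A]. *)
Definition subalg : CStarAlg.
Proof.
refine {| car := subcar;
  zr := exist _ 0 sub_zr;
  un := exist _ 1 sub_un;
  add := fun x y => exist _ (proj1_sig x + proj1_sig y) (sub_add _ _ (proj2_sig x) (proj2_sig y));
  opp := fun x => exist _ (- proj1_sig x) (sub_opp _ (proj2_sig x));
  mul := fun x y => exist _ (proj1_sig x * proj1_sig y) (sub_mul _ _ (proj2_sig x) (proj2_sig y));
  scal := fun z x => exist _ (scal z (proj1_sig x)) (sub_scal z _ (proj2_sig x));
  star := fun x => exist _ (star (proj1_sig x)) (sub_star _ (proj2_sig x));
  nrm := fun x => nrm (proj1_sig x);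
  complete := subcar_complete |};
  intros; try apply subcar_eq; simpl.
- apply addA.
- apply addC.
- apply add0.
- apply addN.
- apply scal1.
- apply scalA.
- apply scalDl.
- apply scalDr.
- apply mulA.
- apply mul1l.
- apply mul1r.
- apply mulDl.
- apply mulDr.
- apply scal_mull.
- apply scal_mulr.
- apply star_add.
- apply star_scal.
- apply star_mul.
- apply star_star.
- now apply nrm_eq0.
- apply nrm_triangle.
- apply nrm_scal.
- apply nrm_submul.
- apply cstar_id.
Defined.

Let mk x (Sx : S x) : subalg := exist _ x Sx.

Lemma subalg_comm (x y : subalg) : x * y = y * x.
Proof. apply subcar_eq. simpl. apply sub_comm; apply proj2_sig. Qed.

Lemma subalg_selfadj (x : subalg) : selfadj subalg x <-> selfadj A (proj1_sig x).
Proof.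
unfold selfadj. split; intro H.
- exact (f_equal (@proj1_sig _ _) H).
- now apply subcar_eq.
Qed.

Lemma char_restrict l : isChar A S l -> char subalg (fun x => l (proj1_sig x)).
Proof.
intros [H1 [H2 [H3 [H4 _]]]]. split; [|split; [|split; [|split]]].
- intros x y _ _. apply H1; apply proj2_sig.
- intros z x _. apply H2; apply proj2_sig.
- intros x y _ _. apply H3; apply proj2_sig.
- exact H4.
- intros x Hx. now destruct Hx.
Qed.

Lemma char_extend (l : subalg -> Cpx) : char subalg l ->
  exists l', isChar A S l' /\ forall x : subalg, l' (proj1_sig x) = l x.
Proof.
intro Hl.
set (l' := fun x => match excluded_middle_informative (S x) with
  left Sx => l (mk x Sx) | right _ => Czero end).
assert (E : forall x : subalg, l' (proj1_sig x) = l x).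
{ intros [x Sx]. unfold l'. simpl. destruct excluded_middle_informative as [Sx'|n]; [|now destruct n].
  f_equal. now apply subcar_eq. }
assert (Out : forall x, ~ S x -> l' x = Czero).
{ intros x Hx. unfold l'. now destruct excluded_middle_informative. }
assert (Em : forall x (Sx : S x), l' x = l (mk x Sx)) by (intros x Sx; apply (E (mk x Sx))).
exists l'. split; [split; [|split; [|split; [|split]]]|assumption].
- intros x y Sx Sy. rewrite (Em x Sx), (Em y Sy). rewrite <- (charD subalg l Hl). exact (E (mk x Sx + mk y Sy)).
- intros z x Sx. rewrite (Em x Sx). rewrite <- (char_scal subalg l Hl). exact (E (scal z (mk x Sx))).
- intros x y Sx Sy. rewrite (Em x Sx), (Em y Sy). rewrite <- (charM subalg l Hl). exact (E (mk x Sx * mk y Sy)).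
- rewrite (Em 1 sub_un). apply (char1 subalg l Hl).
- exact Out.
Qed.

Section SubChar.
Variable l : A -> Cpx.
Hypothesis Hl : isChar A S l.
Let Hl' := char_restrict l Hl.

Lemma schar_star x : S x -> l (star x) = Cconj (l x).
Proof. intro Sx. exact (char_star subalg subalg_comm _ Hl' (mk x Sx)). Qed.

Lemma schar_im_selfadj a : S a -> selfadj A a -> snd (l a) = 0%R.
Proof.
intros Sa Ha. apply (char_im_selfadj subalg subalg_comm _ Hl' (mk a Sa)). now apply subalg_selfadj.
Qed.

Lemma schar_selfadj a : S a -> selfadj A a -> l a = (fst (l a), 0%R).
Proof. intros Sa Ha. rewrite <- (schar_im_selfadj a Sa Ha). now destruct (l a). Qed.

Lemma schar_cst (r : R) : l (cst r) = (r, 0%R).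
Proof. exact (char_cst subalg _ Hl' r). Qed.

Lemma schar_zr : l 0 = Czero.
Proof. rewrite <- cst0. apply schar_cst. Qed.

Lemma schar_re_D x y : S x -> S y -> fst (l (x + y)) = (fst (l x) + fst (l y))%R.
Proof. intros Sx Sy. exact (char_re_D subalg _ Hl' (mk x Sx) (mk y Sy)). Qed.

Lemma schar_B x y : S x -> S y -> l (x - y) = Csub (l x) (l y).
Proof.
intros Sx Sy. unfold sub. pose proof Hl as [H1 [H2 _]]. rewrite oppE, H1, H2 by auto using sub_scal.
unfold Cadd, Cmul, Csub; simpl. f_equal; ring.
Qed.

Lemma schar_re_B x y : S x -> S y -> fst (l (x - y)) = (fst (l x) - fst (l y))%R.
Proof. intros Sx Sy. now rewrite schar_B. Qed.

Lemma schar_re_M x y : S x -> S y -> selfadj A x -> fst (l (x * y)) = (fst (l x) * fst (l y))%R.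
Proof.
intros Sx Sy Ax. apply (char_re_M subalg subalg_comm _ Hl' (mk x Sx) (mk y Sy)).
now apply subalg_selfadj.
Qed.

Lemma schar_rscal (r : R) x : S x -> selfadj A x -> fst (l (rscal A r x)) = (r * fst (l x))%R.
Proof.
intros Sx Ax. unfold rscal. pose proof Hl as [_ [H2 _]]. rewrite H2 by assumption. simpl. ring.
Qed.

Lemma schar_le_nrm a : S a -> selfadj A a -> (fst (l a) <= nrm a)%R.
Proof.
intros Sa Aa. apply (char_le_nrm subalg subalg_comm _ Hl' (mk a Sa)); [|apply Rle_refl].
now apply subalg_selfadj.
Qed.

(* An inverse [y] in [A] of a selfadjoint [b] with [l b = 0] is impossible: [f = d / (b^2 + d)]
   has [l f = 1], hence norm at least 1, while [f = d (1 - f) y^2] has small norm for small [d]. *)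
Lemma schar_selfadj_invertible b : S b -> selfadj A b -> invertible A b -> fst (l b) <> 0%R.
Proof.
intros Sb Ab [y [Hy _]] Hb.
set (Y := nrm (y * y)). assert (HY : (0 <= Y)%R) by apply nrm_ge0.
(* With [d Y <= 1/3], the bound [nrm F <= d (1 + nrm F) Y] gives [nrm F <= 1/2]. *)
set (d := (/ (3 * (Y + 1)))%R).
assert (Hd : (0 < d)%R) by (apply Rinv_0_lt_compat; lra).
assert (HdY : (d * Y <= / 3)%R).
{ apply Rmult_le_reg_r with (3 * (Y + 1))%R; [lra|]. unfold d.
  replace (/ (3 * (Y + 1)) * Y * (3 * (Y + 1)))%R with Y by (field; lra). lra. }
set (b' := mk b Sb). assert (Ab' : selfadj subalg b') by now apply subalg_selfadj.
destruct (exists_resolvent subalg subalg_comm b' d Hd Ab') as [f [Af E1]].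
assert (Lf : (1 <= nrm f)%R).
{ assert (E := f_equal (fun x : subalg => fst (l (proj1_sig x))) E1).
  cbv beta in E.
  rewrite (char_re_M subalg subalg_comm _ Hl' f), (char_re_M subalg subalg_comm _ Hl' b'),
    (char_re_M subalg subalg_comm _ Hl'), (char_re_B subalg _ Hl'),
    (char1 subalg _ Hl'), (char_cst subalg _ Hl') in E by auto using subalg_comm with selfadj.
  change (proj1_sig b') with b in E. rewrite Hb in E. simpl in E.
  generalize (char_le_nrm subalg subalg_comm _ Hl' f _ Af (Rle_refl _)). simpl in *. nra. }
set (F := proj1_sig f : A).
assert (E : F = cst d * ((1 - F) * (y * y))).
{ apply (f_equal (@proj1_sig _ _)) in E1. simpl in E1. fold F in E1.
  change (F * (b * b) = cst d * (1 - F)) in E1.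
  rewrite mulA, <- E1, <- !mulA, (mulA A b y), Hy, mul1l, Hy. now rewrite mul1r. }
assert (NF : (nrm F <= d * ((1 + nrm F) * Y))%R).
{ rewrite E at 1. rewrite nrm_cstM, Rabs_right by lra. apply Rmult_le_compat_l; [lra|].
  eapply Rle_trans; [apply nrm_submul|]. apply Rmult_le_compat_r; [exact HY|].
  generalize (nrm_triangleB A 1 F) (nrm1 A). lra. }
change (1 <= nrm F)%R in Lf. nra.
Qed.

(** [l] kills [a - l a], which is therefore not invertible even in [A]; so [l a] is a spectral value
    of [a]. *)
Lemma schar_positive a : S a -> Defs.positive A a -> (0 <= fst (l a))%R.
Proof.
intros Sa [Aa Ha]. apply Rnot_lt_le. intro Hlt.
assert (Hinv : invertible A (a - cst (fst (l a)))).
{ apply NNPP. intro Hn. destruct (Ha (fst (l a), 0%R)) as [_ H]; [exact Hn|]. simpl in H. lra. }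
refine (schar_selfadj_invertible (a - cst (fst (l a))) _ _ Hinv _).
- auto using sub_sub, sub_cst.
- auto with selfadj.
- rewrite schar_re_B, schar_cst by auto using sub_cst. simpl. ring.
Qed.

End SubChar.

(** An inverse in [S] is an inverse in [A], so every spectral value in [A] is attained by a
    character of [S]. *)
Lemma positive_of_schar a : S a -> selfadj A a ->
  (forall l, isChar A S l -> (0 <= fst (l a))%R) -> Defs.positive A a.
Proof.
intros Sa Aa H. split; [assumption|]. intros z Hz.
destruct (exists_char_of_noninvertible subalg subalg_comm (mk a Sa - scal z 1)) as [l [Hl E]].
- intros [y Hy]. apply Hz. exists (proj1_sig y). split.
  + exact (f_equal (@proj1_sig _ _) Hy).
  + rewrite subalg_comm in Hy. exact (f_equal (@proj1_sig _ _) Hy).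
- destruct (char_extend l Hl) as [l' [Hl' El]].
  rewrite <- El in E. change (l' (a - scal z 1) = Czero) in E.
  rewrite (schar_B l' Hl') in E by auto using sub_scal, sub_un.
  replace (l' (scal z 1)) with z in E.
  + generalize (H l' Hl') (schar_im_selfadj l' Hl' a Sa Aa). unfold Csub, Czero in E.
    injection E. intros. split; lra.
  + destruct Hl' as [_ [H2 [_ [H4 _]]]]. rewrite H2, H4 by apply sub_un.
    destruct z. unfold Cmul, Cone; simpl. f_equal; ring.
Qed.

Lemma schar_separates x : S x -> selfadj A x ->
  (forall l, isChar A S l -> fst (l x) = 0%R) -> x = 0.
Proof.
intros Sx Ax H. assert (E : mk x Sx = 0).
{ apply char_separates; [exact subalg_comm|now apply subalg_selfadj|].
  intros l Hl. destruct (char_extend l Hl) as [l' [Hl' El]]. rewrite <- El. now apply H. }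
exact (f_equal (@proj1_sig _ _) E).
Qed.

Lemma prec_schar a b : S a -> S b -> selfadj A a -> selfadj A b ->
  (prec A a b <-> exists n, forall l, isChar A S l -> (fst (l a) <= INR n * fst (l b))%R).
Proof.
intros Sa Sb Aa Ab.
assert (Sr : forall n, S (rscal A (INR n) b)) by (intro; now apply sub_scal).
split; intros [n H]; exists n.
- intros l Hl. assert (Hp := schar_positive l Hl _ (sub_sub _ _ (Sr n) Sa) H).
  rewrite (schar_re_B l Hl), (schar_rscal l Hl) in Hp by auto. lra.
- apply positive_of_schar.
  + auto using sub_sub.
  + unfold rscal. rewrite <- cst_mul. apply selfadjB; [|assumption].
    unfold selfadj. now rewrite star_mul, star_cst, Ab, cst_comm.
  + intros l Hl. rewrite (schar_re_B l Hl), (schar_rscal l Hl) by auto. specialize (H l Hl). lra.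
Qed.

Lemma isPosPart_schar a p : S a -> S p -> selfadj A a -> selfadj A p ->
  (isPosPart A a p <-> forall l, isChar A S l -> fst (l p) = Rmax (fst (l a)) 0).
Proof.
intros Sa Sp Aa Ap. split.
- intros [Hp [Hle H0]] l Hl.
  assert (Pp := schar_positive l Hl p Sp Hp).
  assert (Ple := schar_positive l Hl (p - a) (sub_sub _ _ Sp Sa) Hle).
  assert (E : fst (l (p * (p - a))) = 0%R) by now rewrite H0, (schar_zr l Hl).
  rewrite (schar_re_M l Hl), (schar_re_B l Hl) in E by auto using sub_sub.
  rewrite (schar_re_B l Hl) in Ple by auto.
  apply Rmult_integral in E. unfold Rmax. destruct Rle_dec; lra.
- intro H. split; [|split].
  + apply positive_of_schar; auto. intros l Hl. rewrite H by assumption. apply Rmax_r.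
  + apply positive_of_schar; auto using sub_sub with selfadj. intros l Hl.
    rewrite (schar_re_B l Hl), H by auto. generalize (Rmax_l (fst (l a)) 0). lra.
  + apply schar_separates.
    * auto using sub_mul, sub_sub.
    * unfold selfadj. rewrite star_mul, starB, Ap, Aa. apply sub_comm; auto using sub_sub.
    * intros l Hl. rewrite (schar_re_M l Hl), (schar_re_B l Hl), H by auto using sub_sub.
      unfold Rmax. destruct Rle_dec; nra.
Qed.

Lemma exists_isPosPart a : S a -> selfadj A a -> exists p, S p /\ isPosPart A a p.
Proof.
intros Sa Aa.
destruct (exists_positive_part subalg subalg_comm (mk a Sa)) as [[p Sp] [Ap Hp]].
{ now apply subalg_selfadj. }
apply subalg_selfadj in Ap. exists p. split; [assumption|].
apply isPosPart_schar; auto. intros l Hl.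
exact (Hp _ (char_restrict l Hl)).
Qed.

Definition schar_max (l : A -> Cpx) (L : list A) : R :=
  fold_right (fun u r => Rmax (fst (l u)) r) 0%R L.

Lemma schar_compact a (q : R) (U : A -> Prop) : S a -> selfadj A a ->
  (forall u, U u -> S u /\ selfadj A u) ->
  (forall l, isChar A S l -> (q <= fst (l a))%R -> exists u, U u /\ (0 < fst (l u))%R) ->
  exists L K, (forall u, In u L -> U u) /\ (0 <= K)%R /\
    forall l, isChar A S l -> (q <= fst (l a))%R -> (1 <= K * schar_max l L)%R.
Proof.
intros Sa Aa HU H.
destruct (char_compact subalg subalg_comm (mk a Sa) q (fun u => U (proj1_sig u)))
  as [L [K [HL [HK HLK]]]].
- now apply subalg_selfadj.
- intros u Uu. apply subalg_selfadj, HU, Uu.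
- intros l Hl Hq. destruct (char_extend l Hl) as [l' [Hl' El]].
  destruct (H l' Hl') as [u [Uu Hu]].
  + change (l' a) with (l' (proj1_sig (mk a Sa))). now rewrite El.
  + exists (mk u (proj1 (HU u Uu))). split; [assumption|]. now rewrite <- El.
- exists (map (@proj1_sig _ _) L), K. split; [|split; [assumption|]].
  + intros u Hu. apply in_map_iff in Hu. destruct Hu as [v [<- Hv]]. now apply HL.
  + intros l Hl Hq. replace (schar_max l (map (@proj1_sig _ _) L)) with
      (char_max subalg (fun x => l (proj1_sig x)) L).
    * now apply HLK; [apply char_restrict|].
    * clear. induction L as [|u L IH]; simpl; [reflexivity|]. f_equal. exact IH.
Qed.

End Subalgebra.

(** * Positive parts and coverings *)

Section PositivePart.
Variable A : CStarAlg.
Local Open Scope alg_scope.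

Definition commutant (T : A -> Prop) : A -> Prop := fun x => forall y, T y -> x * y = y * x.

Lemma commutant_lim T u l : (forall n, commutant T (u n)) -> converges A u l -> commutant T l.
Proof.
intros Hu Hl y Ty. apply sub_eq0, nrm_small with (2 * nrm y)%R.
{ generalize (nrm_ge0 A y). lra. }
intros eps He. destruct (Hl eps He) as [N HN]. specialize (HN N (Nat.le_refl _)).
assert (E : l * y - y * l = y * (u N - l) - (u N - l) * y).
{ unfold sub. rewrite mulDl, mulDr, (Hu N y Ty), !oppE, <- scal_mull, <- scal_mulr, scalDr, scalA.
  replace (Cmul (-1, 0) (-1, 0))%R with Cone by (unfold Cmul, Cone; simpl; f_equal; ring).
  rewrite scal1, addA, (addC A _ (scal _ (y * u N))), addA.
  rewrite <- !oppE, addNl, add0. apply addC. }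
rewrite E. eapply Rle_trans; [apply nrm_triangleB|].
generalize (nrm_submul A y (u N - l)) (nrm_submul A (u N - l) y) (nrm_ge0 A y).
intros. nra.
Qed.

Definition star_closed (T : A -> Prop) : Prop := forall x, T x -> T (star x).

(** The clauses of [isCommSub] other than commutativity, norm closedness included, as satisfied by
    commutants. *)
Definition star_subalgebra (N : A -> Prop) : Prop :=
  N 1 /\
  (forall x y, N x -> N y -> N (x + y)) /\
  (forall x y, N x -> N y -> N (x * y)) /\
  (forall (z : Cpx) x, N x -> N (scal z x)) /\
  star_closed N /\
  (forall u l, (forall n, N (u n)) -> converges A u l -> N l).

Lemma star_subalgebra_commutant T : star_closed T -> star_subalgebra (commutant T).
Proof.
intro HT. split; [|split; [|split; [|split; [|split]]]].
- intros y _. now rewrite mul1l, mul1r.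
- intros x y Cx Cy t Tt. now rewrite mulDl, mulDr, Cx, Cy.
- intros x y Cx Cy t Tt. now rewrite <- mulA, Cy, mulA, Cx, mulA.
- intros z x Cx t Tt. now rewrite <- scal_mull, <- scal_mulr, Cx.
- intros x Cx y Ty. rewrite <- (star_star A y), <- !star_mul. f_equal. symmetry. now apply Cx, HT.
- apply commutant_lim.
Qed.

Lemma isCommSub_inter S N : isCommSub A S -> star_subalgebra N -> isCommSub A (fun x => S x /\ N x).
Proof.
intros [S1 [S2 [S3 [S4 [S5 [S6 S7]]]]]] [N1 [N2 [N3 [N4 [N5 N6]]]]].
split; [|split; [|split; [|split; [|split; [|split]]]]]; try (intuition auto; fail).
intros u l Hu Hl. split; [apply S7 with u|apply N6 with u]; auto; apply Hu.
Qed.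

Lemma star_subalgebra_bicommutant T : (forall x, T x -> selfadj A x) ->
  star_subalgebra (commutant (commutant T)).
Proof.
intro HT. apply star_subalgebra_commutant.
apply star_subalgebra_commutant. intros x Tx. now rewrite (HT x Tx).
Qed.

Lemma commutant_commutant T x : T x -> commutant (commutant T) x.
Proof. intros Tx y Cy. symmetry. now apply Cy. Qed.

(** A commutative [T] lies in its commutant; hence the bicommutant lies in the commutant too, and it
    commutes with that by definition. *)
Lemma isCommSub_bicommutant T : (forall x, T x -> selfadj A x) ->
  (forall x y, T x -> T y -> x * y = y * x) -> isCommSub A (commutant (commutant T)).
Proof.
intros HT Hc. destruct (star_subalgebra_bicommutant T HT) as [H1 [H2 [H3 [H4 [H5 H6]]]]].
do 5 (split; [assumption|]). split; [|assumption].
intros x y Cx Cy. apply Cx. intros t Tt. apply Cy. intros t' Tt'. now apply Hc.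
Qed.

(* [p] commutes with [a] because [p^2 = p a]; hence [p], [q] and [a] commute, and [p] and [q] are
   compared by the characters of the bicommutant they generate. *)
Lemma isPosPart_unique a p q : selfadj A a -> isPosPart A a p -> isPosPart A a q ->
  commutant (commutant (fun x => x = a)) q -> p = q.
Proof.
intros Aa Hp Hq Cq.
assert (Ap : selfadj A p) by apply Hp. assert (Aq : selfadj A q) by apply Hq.
assert (Hpp : p * p = p * a).
{ apply sub_eq0. rewrite <- (proj2 (proj2 Hp)). unfold sub. now rewrite mulDr, !oppE, <- scal_mulr. }
assert (Hpa : p * a = a * p).
{ rewrite <- Hpp. generalize (f_equal star Hpp). now rewrite !star_mul, Ap, Aa. }
assert (Hqp : q * p = p * q) by (apply Cq; now intros x ->).
assert (Hqa : q * a = a * q) by (apply Cq; now intros x ->).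
set (T := fun x => x = a \/ x = p \/ x = q).
assert (HN : isCommSub A (commutant (commutant T))).
{ apply isCommSub_bicommutant.
  - now intros x [->|[->| ->]].
  - intros x y [->|[->| ->]] [->|[->| ->]]; congruence. }
assert (Ta := commutant_commutant T a (or_introl eq_refl)).
assert (Tp := commutant_commutant T p (or_intror (or_introl eq_refl))).
assert (Tq := commutant_commutant T q (or_intror (or_intror eq_refl))).
apply sub_eq0, (schar_separates A _ HN); [now apply sub_sub|auto with selfadj|].
intros l Hl. rewrite (schar_re_B A _ HN l Hl) by assumption.
rewrite (proj1 (isPosPart_schar A _ HN a p Ta Tp Aa Ap) Hp l Hl).
rewrite (proj1 (isPosPart_schar A _ HN a q Ta Tq Aa Aq) Hq l Hl). ring.
Qed.

Lemma schar_max_pos (l : A -> Cpx) L : (0 < schar_max A l L)%R -> exists u, In u L /\ (0 < fst (l u))%R.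
Proof.
induction L as [|u L IH]; simpl; [lra|]. unfold Rmax. destruct Rle_dec.
- intro H. destruct (IH H) as [v [Hv Hp]]. exists v. auto.
- intro H. exists u. auto.
Qed.

Lemma schar_max_nonneg (l : A -> Cpx) L : (0 <= schar_max A l L)%R.
Proof. induction L; simpl; [lra|]. eapply Rle_trans; [eassumption|apply Rmax_r]. Qed.

Section InSub.
Variable S : A -> Prop.
Hypothesis HS : isCommSub A S.

Let subB := sub_sub A S HS.
Let subC := sub_cst A S HS.

(** A positive part is built in the intersection of [S] with the bicommutant of [a]: the second
    condition identifies it with the chosen [posp A a], and the first then places the latter in
    [S]. *)
Lemma posp_spec a : S a -> selfadj A a -> S (posp A a) /\ isPosPart A a (posp A a).
Proof.
intros Sa Aa.
assert (HN : isCommSub A (fun x => S x /\ commutant (commutant (fun x => x = a)) x)).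
{ apply isCommSub_inter; [assumption|]. apply star_subalgebra_bicommutant. intros x ->. exact Aa. }
destruct (exists_isPosPart A _ HN a) as [q [[Sq Cq] Hq]]; [|assumption|].
- split; [assumption|]. now apply commutant_commutant.
- assert (Hp : isPosPart A a (posp A a)) by (unfold posp; apply epsilon_spec; now exists q).
  split; [|assumption]. now rewrite (isPosPart_unique a (posp A a) q).
Qed.

Lemma posp_in a : S a -> selfadj A a -> S (posp A a).
Proof. intros. now apply posp_spec. Qed.

Lemma posp_positive a : S a -> selfadj A a -> Defs.positive A (posp A a).
Proof. intros. now apply posp_spec. Qed.

Lemma posp_selfadj a : S a -> selfadj A a -> selfadj A (posp A a).
Proof. intros. now apply posp_positive. Qed.

Lemma schar_posp l a : isChar A S l -> S a -> selfadj A a -> fst (l (posp A a)) = Rmax (fst (l a)) 0.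
Proof.
intros Hl Sa Aa. apply (isPosPart_schar A S HS); auto using posp_in, posp_selfadj.
now apply posp_spec.
Qed.

Lemma posp_of_positive a : S a -> Defs.positive A a -> posp A a = a.
Proof.
intros Sa Ha. assert (Aa : selfadj A a) by apply Ha.
apply sub_eq0, (schar_separates A S HS); auto using subB, posp_in, posp_selfadj with selfadj.
intros l Hl. rewrite (schar_re_B A S HS l Hl), schar_posp by auto using posp_in.
rewrite Rmax_left; [ring|]. now apply (schar_positive A S HS).
Qed.

Lemma sup_spec x y : S x -> selfadj A x -> S y -> selfadj A y ->
  S (sup A x y) /\ selfadj A (sup A x y) /\
  forall l, isChar A S l -> fst (l (sup A x y)) = Rmax (fst (l x)) (fst (l y)).
Proof.
intros Sx Ax Sy Ay.
assert (Sd : S (y - x)) by now apply (sub_sub A S HS).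
assert (Ad : selfadj A (y - x)) by auto with selfadj.
unfold sup. split; [|split].
- apply (sub_add A S HS); auto using posp_in.
- apply selfadjD; auto using posp_selfadj.
- intros l Hl. rewrite (schar_re_D A S HS l Hl), schar_posp, (schar_re_B A S HS l Hl) by auto using posp_in.
  unfold Rmax. destruct Rle_dec; destruct Rle_dec; lra.
Qed.

Lemma bigsup_spec L : (forall u, In u L -> S u /\ selfadj A u) ->
  S (bigsup A L) /\ selfadj A (bigsup A L) /\
  forall l, isChar A S l -> fst (l (bigsup A L)) = schar_max A l L.
Proof.
induction L as [|u L IH]; intro HL.
- split; [|split].
  + apply (sub_zr A S HS).
  + apply selfadj0.
  + intros l Hl. simpl. now rewrite (schar_zr A S HS l Hl).
- destruct IH as [S1 [A1 H1]]; [intros v Hv; apply HL; now right|].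
  destruct (HL u) as [Su Au]; [now left|].
  destruct (sup_spec u (bigsup A L) Su Au S1 A1) as [S2 [A2 H2]].
  split; [assumption|]. split; [assumption|]. intros l Hl. simpl. now rewrite H2, H1.
Qed.

(** The margin [q] reconciles a finite join with the merely open set [X_a]: each point of [X_a]
    survives a small enough [q], and for fixed [q] the compact set where [q <= l a] needs only
    finitely many [u]. *)
Lemma covers_schar a (U : A -> Prop) : S a -> selfadj A a -> (forall u, U u -> Cpos A S u) ->
  (covers A S a U <->
   forall l, isChar A S l -> (0 < fst (l a))%R -> exists u, U u /\ (0 < fst (l u))%R).
Proof.
intros Sa Aa HU.
assert (HU' : forall u, U u -> S u /\ selfadj A u) by (intros u Uu; destruct (HU u Uu) as [? []]; auto).
assert (Sq : forall r : R, S (a - cst r)) by (intro; auto using subB, subC).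
assert (Aq : forall r : R, selfadj A (a - cst r)) by (intro; auto with selfadj).
assert (Hprec : forall (r : R) L, (forall u, In u L -> U u) ->
  (prec A (posp A (a - cst r)) (bigsup A L) <->
   exists n, forall l, isChar A S l -> (Rmax (fst (l a) - r) 0 <= INR n * schar_max A l L)%R)).
{ intros r L HL. destruct (bigsup_spec L) as [Sb [Ab Hb]]; [auto|].
  rewrite (prec_schar A S HS) by auto using posp_in, posp_selfadj.
  split; intros [n H]; exists n; intros l Hl; specialize (H l Hl);
    rewrite schar_posp, (schar_re_B A S HS l Hl), (schar_cst A S HS l Hl), Hb in *
      by auto using subC; exact H. }
split.
- intros H l Hl Hpos. destruct (exists_small_Q _ Hpos) as [q [Hq Hqa]].
  destruct (H q Hq) as [L [HL Hp]]. apply (Hprec (Q2R q) L HL) in Hp. destruct Hp as [n Hn].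
  specialize (Hn l Hl). rewrite Rmax_left in Hn by lra.
  destruct (schar_max_pos l L) as [u [Hu Hup]].
  + generalize (pos_INR n). intro. apply Rnot_le_lt. intro. nra.
  + exists u. auto.
- intros H q Hq. assert (Hr : (0 < Q2R q)%R) by (apply Qlt_Rlt in Hq; unfold Q2R in Hq at 1; simpl in Hq; lra).
  destruct (schar_compact A S HS a (Q2R q) U Sa Aa HU') as [L [K [HL [HK HLK]]]].
  { intros l Hl Hle. apply H; [assumption|lra]. }
  exists L. split; [assumption|]. apply (Hprec (Q2R q) L HL).
  (* Where [q <= l a], the left side is at most [nrm a], hence at most [nrm a * K] times the maximum
     over [L]; elsewhere it is 0. *)
  destruct (INR_unbounded (nrm a * K)) as [n Hn]. exists n. intros l Hl.
  assert (Hm := schar_max_nonneg l L).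
  assert (Hn0 := pos_INR n). apply Rmax_lub; [|nra].
  destruct (Rle_dec (Q2R q) (fst (l a))) as [Hle|]; [|nra].
  specialize (HLK l Hl Hle). generalize (schar_le_nrm A S HS l Hl a Sa Aa) (nrm_ge0 A a). intros.
  assert (nrm a <= (nrm a * K) * schar_max A l L)%R; [|nra].
  rewrite Rmult_assoc. rewrite <- (Rmult_1_r (nrm a)) at 1. now apply Rmult_le_compat_l.
Qed.

End InSub.
End PositivePart.

(** * The frame isomorphism *)

Section Families.
Variable A : CStarAlg.
Local Open Scope alg_scope.

Lemma Cpos_selfadj S x : Cpos A S x -> selfadj A x.
Proof. now intros [_ []]. Qed.

Lemma Psi_iff (U : fam A) S l : (forall x, U S x -> Cpos A S x) -> isPt A (S, l) ->
  (Psi A U (S, l) <-> exists a, U S a /\ (0 < fst (l a))%R).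
Proof.
intros HU Hp. split.
- intros [_ [a [Ua [r [Hr E]]]]]. exists a. split; [assumption|]. simpl in E. now rewrite E.
- intros [a [Ua Ha]]. split; [assumption|]. exists a. split; [assumption|]. exists (fst (l a)).
  split; [assumption|]. destruct Hp as [HS Hl].
  apply (schar_selfadj A S HS l Hl); [|apply Cpos_selfadj with S]; now apply HU.
Qed.

Lemma inF_Cpos U S x : inF A U -> U S x -> Cpos A S x.
Proof. intros HU Ux. now apply HU. Qed.

(** Condition (ii) read on the spectrum: [U S] is recovered from the open set it induces.
    Injectivity and preservation of meets rest on this. *)
Lemma inF_schar U S a : inF A U -> isCommSub A S -> Cpos A S a ->
  (U S a <-> forall l, isChar A S l -> (0 < fst (l a))%R -> exists u, U S u /\ (0 < fst (l u))%R).
Proof.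
intros HU HS Ha. assert (Aa := Cpos_selfadj S a Ha). destruct Ha as [Sa Pa].
rewrite <- (covers_schar A S HS a (U S) Sa Aa) by (intros u; now apply inF_Cpos).
rewrite <- (posp_of_positive A S HS a Sa Pa) at 1.
apply HU; assumption.
Qed.

Lemma Psi_mono U S S' l l' : inF A U -> Psi A U (S, l) -> isCommSub A S' -> subset A S S' ->
  isChar A S' l' -> (forall x, S x -> l' x = l x) -> Psi A U (S', l').
Proof.
intros HU [[HS Hl] [a [Ua [r [Hr E]]]]] HS' Hsub Hl' Hll. simpl in *.
destruct (inF_Cpos U S a HU Ua) as [Sa Pa].
split; [now split|]. exists a. split.
- assert (Ep := posp_of_positive A S HS a Sa Pa). simpl. rewrite <- Ep.
  destruct HU as [_ [_ [Hm _]]]. apply (Hm S S'); auto; [apply Pa|now rewrite Ep].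
- exists r. split; [assumption|]. simpl. now rewrite Hll.
Qed.

Lemma isOpen_Psi U : inF A U -> isOpen A (Psi A U).
Proof.
intro HU. split; [|split].
- now intros p [].
- intros S HS l Hl HO.
  apply Psi_iff in HO; [|intro; now apply inF_Cpos|now split].
  (* Within distance [l a] of [l a], the real number [m a] stays positive. *)
  destruct HO as [a [Ua Ha]]. exists (a :: nil), (fst (l a)).
  destruct (inF_Cpos U S a HU Ua) as [Sa [Aa _]].
  split; [assumption|]. split; [now intros x [<-|[]]|].
  intros m Hm Hma. apply Psi_iff; [intro; now apply inF_Cpos|now split|].
  exists a. split; [assumption|]. specialize (Hma a (or_introl eq_refl)).
  generalize (Cmod_sq (Csub (m a) (l a))) (Cmod_ge0 (Csub (m a) (l a))). simpl.
  rewrite (schar_im_selfadj A S HS m Hm a Sa Aa), (schar_im_selfadj A S HS l Hl a Sa Aa). nra.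
- intros S S' l l' HO HS' Hsub Hl' Hll. now apply Psi_mono with S l.
Qed.

Lemma Psi_injective U V : inF A U -> inF A V -> Psi A U = Psi A V -> U = V.
Proof.
assert (H : forall U V, inF A U -> inF A V -> Psi A U = Psi A V -> forall S x, U S x -> V S x).
{ clear U V. intros U V HU HV E S x Ux. destruct (proj1 HU S x Ux) as [HS Hx].
  apply inF_schar; auto. intros l Hl Hpos.
  assert (HO : Psi A U (S, l)) by (apply Psi_iff; [intro; now apply inF_Cpos|now split|now exists x]).
  rewrite E in HO. apply Psi_iff in HO; [assumption|intro; now apply inF_Cpos|now split]. }
intros HU HV E. apply functional_extensionality. intro S. apply functional_extensionality. intro x.
apply propositional_extensionality. split; [apply (H U V)|apply (H V U)]; auto.
Qed.

(** * From open sets back to families *)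

Definition restrict (S : A -> Prop) (l : A -> Cpx) : A -> Cpx :=
  fun x => if excluded_middle_informative (S x) then l x else Czero.

Lemma restrict_in S l x : S x -> restrict S l x = l x.
Proof. intro Sx. unfold restrict. now destruct excluded_middle_informative. Qed.

Lemma isChar_restrict S S' l : isCommSub A S -> subset A S S' -> isChar A S' l ->
  isChar A S (restrict S l).
Proof.
intros HS Hsub [H1 [H2 [H3 [H4 _]]]].
split; [|split; [|split; [|split]]].
- intros x y Sx Sy. assert (S (x + y)) by now apply (sub_add A S HS). rewrite !restrict_in; auto.
- intros z x Sx. assert (S (scal z x)) by now apply (sub_scal A S HS). rewrite !restrict_in; auto.
- intros x y Sx Sy. assert (S (x * y)) by now apply (sub_mul A S HS). rewrite !restrict_in; auto.
- rewrite restrict_in; [assumption|apply (sub_un A S HS)].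
- intros x Sx. unfold restrict. now destruct excluded_middle_informative.
Qed.

(** The inverse of [Psi]: all classes whose basic open set [X_x] lies inside the fibre of [O] over
    [S]. *)
Definition family_of_open (O : Pt A -> Prop) : fam A := fun S x =>
  isCommSub A S /\ Cpos A S x /\ forall l, isChar A S l -> (0 < fst (l x))%R -> O (S, l).

Lemma inF_family_of_open O : isOpen A O -> inF A (family_of_open O).
Proof.
intros [_ [_ Oup]]. split; [|split; [|split]].
- intros S x [HS [Hx _]]. auto.
- intros S x y [HS [Hx Ox]] Hy [_ Hyx]. split; [assumption|]. split; [assumption|].
  intros l Hl Hpos. apply Ox; [assumption|].
  assert (Ax := Cpos_selfadj S x Hx). assert (Ay := Cpos_selfadj S y Hy).
  destruct Hx as [Sx Px], Hy as [Sy Py].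
  apply (prec_schar A S HS) in Hyx; auto. destruct Hyx as [n Hn]. specialize (Hn l Hl).
  generalize (pos_INR n) (schar_positive A S HS l Hl x Sx Px). intros. apply Rnot_le_lt. intro. nra.
- intros S S' a HS HS' Hsub Sa Aa [_ [[Sp Pp] Hp]].
  split; [assumption|]. split; [split; auto|]. intros l' Hl' Hpos.
  apply Oup with S (restrict S l'); auto.
  + apply Hp; [now apply isChar_restrict with S'|]. now rewrite restrict_in.
  + intros x Sx. now rewrite restrict_in.
- intros S a HS Sa Aa. rewrite (covers_schar A S HS a) by (auto; now intros u [_ []]).
  assert (Hval : forall l, isChar A S l -> (0 < fst (l (posp A a)) <-> 0 < fst (l a))%R).
  { intros l Hl. rewrite (schar_posp A S HS) by assumption. unfold Rmax. destruct Rle_dec; lra. }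
  split.
  + intros Hp l Hl Hpos. exists (posp A a). split; [assumption|]. now apply Hval.
  + intro H. split; [assumption|]. split.
    * split; [apply (posp_in A S HS)|apply (posp_positive A S HS)]; assumption.
    * intros l Hl Hpos. apply Hval in Hpos; [|assumption].
      destruct (H l Hl Hpos) as [u [[_ [_ Ou]] Hu]]. now apply Ou.
Qed.

(** At a character [m] its value is the squared Euclidean distance from [m] to [l] along [xs]. It
    serves to place a set [X_a] inside a basic neighbourhood of [openIn]. *)
Definition sqdist (l : A -> Cpx) (xs : list A) : A :=
  fold_right (fun x acc => star (x - scal (l x) 1) * (x - scal (l x) 1) + acc) 0 xs.

Lemma sqdist_spec S l xs : isCommSub A S -> (forall x, In x xs -> S x) ->
  S (sqdist l xs) /\ selfadj A (sqdist l xs) /\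
  forall m, isChar A S m -> fst (m (sqdist l xs)) =
    fold_right (fun x r => Cmod (Csub (m x) (l x)) * Cmod (Csub (m x) (l x)) + r)%R 0%R xs.
Proof.
intros HS Hxs. induction xs as [|x xs IH].
- split; [apply (sub_zr A S HS)|]. split; [apply selfadj0|].
  intros m Hm. simpl. now rewrite (schar_zr A S HS m Hm).
- destruct IH as [S1 [A1 H1]]; [intros; apply Hxs; now right|].
  assert (Sx : S x) by (apply Hxs; now left).
  set (y := x - scal (l x) 1).
  assert (Sc : S (scal (l x) 1)) by apply (sub_scal A S HS), (sub_un A S HS).
  assert (Sy : S y) by now apply (sub_sub A S HS).
  assert (Sy' : S (star y)) by now apply (sub_star A S HS).
  assert (Syy : S (star y * y)) by now apply (sub_mul A S HS).
  split; [now apply (sub_add A S HS)|]. split.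
  + apply selfadjD; [|assumption]. apply selfadj_star_mul.
  + intros m Hm. change (sqdist l (x :: xs)) with (star y * y + sqdist l xs).
    rewrite (schar_re_D A S HS m Hm), H1 by assumption. simpl. f_equal.
    assert (Ey : m y = Csub (m x) (l x)).
    { unfold y. rewrite (schar_B A S HS m Hm) by assumption. f_equal.
      destruct Hm as [_ [H2 [_ [H4 _]]]]. rewrite H2, H4 by apply (sub_un A S HS).
      destruct (l x). unfold Cmul, Cone; simpl. f_equal; ring. }
    assert (Em : m (star y * y) = Cmul (m (star y)) (m y)) by now apply Hm.
    rewrite Em, (schar_star A S HS m Hm y Sy), Ey, Cmod_sq. unfold Cmul, Cconj; simpl. ring.
Qed.

Lemma Psi_family_of_open O : isOpen A O -> Psi A (family_of_open O) = O.
Proof.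
intro HO. assert (HF := inF_family_of_open O HO). destruct HO as [Opt [Oopen _]].
apply functional_extensionality. intros [S l]. apply propositional_extensionality. split.
- intros [[HS Hl] [a [[_ [_ Oa]] [r [Hr E]]]]]. simpl in *. apply Oa; [assumption|]. now rewrite E.
- intro Ol. assert (Hp := Opt _ Ol). apply Psi_iff; [intro; now apply inF_Cpos|assumption|].
  destruct Hp as [HS Hl]. simpl in HS, Hl.
  destruct (Oopen S HS l Hl Ol) as [xs [eps [He [Hxs HW]]]].
  destruct (sqdist_spec S l xs HS Hxs) as [Sg [Ag Hg]].
  (* [X_a] is the Euclidean ball of radius [eps] around [l], contained in the coordinatewise box of
     the same radius. *)
  set (a := cst (eps * eps) - sqdist l xs).
  assert (Sa : S a) by (apply (sub_sub A S HS); [apply (sub_cst A S HS)|assumption]).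
  assert (Aa : selfadj A a) by (apply selfadjB; [apply selfadj_cst|assumption]).
  assert (Ha : forall m, isChar A S m -> fst (m (posp A a)) = Rmax (eps * eps - fst (m (sqdist l xs))) 0).
  { intros m Hm. rewrite (schar_posp A S HS) by assumption. unfold a.
    rewrite (schar_re_B A S HS m Hm), (schar_cst A S HS m Hm); auto. apply (sub_cst A S HS). }
  exists (posp A a). split.
  + split; [assumption|]. split.
    * split; [apply (posp_in A S HS)|apply (posp_positive A S HS)]; assumption.
    * intros m Hm Hpos. apply HW; [assumption|]. rewrite Ha in Hpos by assumption.
      assert (Hlt : (fst (m (sqdist l xs)) < eps * eps)%R).
      { unfold Rmax in Hpos. destruct Rle_dec in Hpos; lra. }
      rewrite Hg in Hlt by assumption. clear - Hlt He. intros x Hx.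
      assert (Hle : (Cmod (Csub (m x) (l x)) * Cmod (Csub (m x) (l x)) < eps * eps)%R).
      { eapply Rle_lt_trans; [|exact Hlt]. clear - Hx.
        assert (Hn : forall ys, (0 <= fold_right (fun x r =>
          Cmod (Csub (m x) (l x)) * Cmod (Csub (m x) (l x)) + r) 0 ys)%R).
        { induction ys; simpl; nra. }
        induction xs as [|y xs IH]; [destruct Hx|]. simpl. destruct Hx as [->|Hx].
        - specialize (Hn xs). lra.
        - specialize (IH Hx). nra. }
      generalize (Cmod_ge0 (Csub (m x) (l x))). intro. apply Rnot_le_lt. intro. nra.
  + rewrite Ha by assumption. apply Rlt_le_trans with (eps * eps)%R; [nra|].
    eapply Rle_trans; [|apply Rmax_l]. rewrite Hg by assumption.
    assert (E : fold_right (fun x r => Cmod (Csub (l x) (l x)) * Cmod (Csub (l x) (l x)) + r)%R 0%R xs = 0%R).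
    { clear. induction xs as [|x xs IH]; simpl; [reflexivity|]. rewrite IH, Cmod_sq. simpl. ring. }
    rewrite E. lra.
Qed.

Lemma Psi_topF : Psi A (topF A) = isPt A.
Proof.
apply functional_extensionality. intros [S l]. apply propositional_extensionality. split.
- now intros [].
- intros [HS Hl]. simpl in HS, Hl. split; [now split|]. exists 1. split.
  + split; [assumption|]. split; [apply (sub_un A S HS)|].
    apply (positive_of_schar A S HS); [apply (sub_un A S HS)|apply selfadj1|].
    intros m Hm. rewrite (proj1 (proj2 (proj2 (proj2 Hm)))). simpl. lra.
  + exists 1%R. split; [lra|]. apply Hl.
Qed.

(** For positive [a] and [b], [X_(a b)] is the intersection of [X_a] and [X_b]; lying below both,
    the product belongs to both families. *)
Lemma Psi_meetF U V : inF A U -> inF A V ->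
  Psi A (meetF A U V) = (fun p => Psi A U p /\ Psi A V p).
Proof.
intros HU HV. apply functional_extensionality. intros [S l]. apply propositional_extensionality. split.
- intros [Hp [a [[Ua Va] H]]]. split; split; try assumption; now exists a.
- intros [HOU HOV]. assert (Hp : isPt A (S, l)) by apply HOU. destruct Hp as [HS Hl]. simpl in HS, Hl.
  apply Psi_iff in HOU; [|intro; now apply inF_Cpos|now split].
  apply Psi_iff in HOV; [|intro; now apply inF_Cpos|now split].
  destruct HOU as [a [Ua Ha]], HOV as [b [Vb Hb]].
  destruct (inF_Cpos U S a HU Ua) as [Sa Pa], (inF_Cpos V S b HV Vb) as [Sb Pb].
  assert (Aa : selfadj A a) by apply Pa. assert (Ab : selfadj A b) by apply Pb.
  assert (Hval : forall m, isChar A S m -> (fst (m (a * b)%alg) = fst (m a) * fst (m b) /\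
    0 <= fst (m a) /\ 0 <= fst (m b))%R).
  { intros m Hm. split; [now apply (schar_re_M A S HS m Hm)|].
    split; now apply (schar_positive A S HS). }
  assert (Hab : Cpos A S (a * b)).
  { assert (Sab : S (a * b)) by now apply (sub_mul A S HS).
    split; [assumption|]. apply (positive_of_schar A S HS); [assumption| |].
    - unfold selfadj. rewrite star_mul, Aa, Ab. now apply (sub_comm A S HS).
    - intros m Hm. destruct (Hval m Hm) as [-> []]. nra. }
  apply Psi_iff; [intros x [Ux _]; now apply (inF_Cpos U)|now split|].
  exists (a * b). split; [split|].
  + apply inF_schar; auto. intros m Hm Hpos. exists a. split; [assumption|].
    destruct (Hval m Hm) as [E []]. apply Rnot_le_lt. intro. nra.
  + apply inF_schar; auto. intros m Hm Hpos. exists b. split; [assumption|].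
    destruct (Hval m Hm) as [E []]. apply Rnot_le_lt. intro. nra.
  + rewrite (proj1 (Hval l Hl)). nra.
Qed.

(** Closing the union under coverings adds no point: a covered [a] has [X_a] inside the union
    already. *)
Lemma Psi_joinF (I : Type) (Us : I -> fam A) : (forall i, inF A (Us i)) ->
  Psi A (joinF A I Us) = (fun p => exists i, Psi A (Us i) p).
Proof.
intro HUs. apply functional_extensionality. intros [S l]. apply propositional_extensionality.
assert (HU : forall S y, (exists i, Us i S y) -> Cpos A S y).
{ intros S' y [i Ui]. now apply (inF_Cpos (Us i)). }
split.
- intro HO. assert (Hp : isPt A (S, l)) by apply HO. destruct Hp as [HS Hl]. simpl in HS, Hl.
  apply Psi_iff in HO; [|now intros x [_ []]|now split].
  destruct HO as [a [[_ [Ha Hc]] Hpos]].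
  destruct (proj1 (covers_schar A S HS a _ (proj1 Ha) (Cpos_selfadj S a Ha) (HU S)) Hc l Hl Hpos) as [u [[i Ui] Hu]]. exists i.
  apply Psi_iff; [intro; now apply inF_Cpos|now split|]. now exists u.
- intros [i HO]. assert (Hp : isPt A (S, l)) by apply HO.
  apply Psi_iff in HO; [|intro; now apply inF_Cpos|assumption].
  destruct HO as [u [Ui Hu]], Hp as [HS Hl]. simpl in HS, Hl.
  assert (Hu' : Cpos A S u) by (apply HU; now exists i).
  apply Psi_iff; [now intros x [_ []]|now split|].
  exists u. split; [|assumption]. split; [assumption|]. split; [assumption|].
  apply (covers_schar A S HS u _ (proj1 Hu') (Cpos_selfadj S u Hu') (HU S)).
  intros m Hm Hpos. exists u. split; [now exists i|assumption].
Qed.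

End Families.

Theorem theorem2p17 (A : CStarAlg) :
  (* well defined *)
  (forall U, inF A U -> isOpen A (Psi A U)) /\
  (* injective *)
  (forall U V, inF A U -> inF A V -> Psi A U = Psi A V -> U = V) /\
  (* surjective *)
  (forall O, isOpen A O -> exists U, inF A U /\ Psi A U = O) /\
  (* preserves top *)
  Psi A (topF A) = isPt A /\
  (* preserves binary meets *)
  (forall U V, inF A U -> inF A V ->
     Psi A (meetF A U V) = (fun p => Psi A U p /\ Psi A V p)) /\
  (* preserves arbitrary joins *)
  (forall (I : Type) (Us : I -> fam A), (forall i, inF A (Us i)) ->
     Psi A (joinF A I Us) = (fun p => exists i, Psi A (Us i) p)).
Proof.
split; [apply isOpen_Psi|].
split; [apply Psi_injective|].
split.
{ intros O HO. exists (family_of_open A O).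
  split; [now apply inF_family_of_open|now apply Psi_family_of_open]. }
split; [apply Psi_topF|].
split; [apply Psi_meetF|apply Psi_joinF].
Qed.
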